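(* Let $p\in[2,\infty)$ and let $(Y,\mathcal{M},\mu)$ be a measure space with $\mu(Y)<\infty$. Let $(e_n)_{n\in\mathbb{N}^\star}$ be an orthonormal basis of $L^2(Y,\mathcal{M},\mu)$, and let $(g_n)_{n\in\mathbb{N}^\star}$ be a sequence of independent $\mathcal{N}_{\mathbb{C}}(0,1)$ Gaussian random variables on a probability space $(\Omega,\mathcal{A},P)$. For $c=(c_n)_{n\in\mathbb{N}^\star}\in l^2(\mathbb{N}^\star)$ consider the random series $$F_c(\omega)=\sum_{n\in\mathbb{N}^\star} g_n(\omega)\,c_n\,e_n .$$ Then the following two statements are equivalent: (a) For every sequence $c\in l^2(\mathbb{N}^\star)$, one has $\|F_c(\omega)\|_{L^p(Y,\mathcal{M},\mu)}<\infty$ almost surely. (b) $\sup_{n\in\mathbb{N}^\star}\|e_n\|_{L^p(Y,\mathcal{M},\mu)}<\infty$.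
   Context: $\mathbb{N}^\star=\{1,2,3,\dots\}$. $L^p$ and $l^2(\mathbb{N}^\star)$ are spaces of complex-valued functions and sequences. An $\mathcal{N}_{\mathbb{C}}(0,\sigma^2)$ Gaussian random variable ($\sigma>0$) is a complex-valued random variable with density $\frac{1}{2\pi\sigma^2}e^{-|z|^2/(2\sigma^2)}$ on $\mathbb{C}$; equivalently $X=X_1+iX_2$ with $X_1,X_2$ independent real centered Gaussians of variance $\sigma^2$, so $\mathbb{E}|X|^2=2\sigma^2$. The series $F_c$ is defined as the limit in $L^2(\Omega\times Y)$ (with respect to $P\otimes\mu$) of its partial sums; for $P$-almost every $\omega$, $F_c(\omega)\in L^2(Y,\mathcal{M},\mu)$ and its coordinates in the basis $(e_n)$ are $g_n(\omega)c_n$. For $f\in L^2(Y,\mathcal{M},\mu)$, $\|f\|_{L^p(Y,\mathcal{M},\mu)}=\left(\int_Y|f|^p\,d\mu\right)^{1/p}\in[0,\infty]$, with value $\infty$ if $f\notin L^p$. *)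

(* Defs.v *)
From HB Require Import structures.
From mathcomp Require Import all_boot all_order all_algebra.
From mathcomp Require Import complex finmap.
From mathcomp Require Import all_classical all_reals all_analysis.

Set Implicit Arguments.
Unset Strict Implicit.
Unset Printing Implicit Defensive.
Import Order.TTheory GRing.Theory Num.Theory.
Import numFieldNormedType.Exports.

Local Open Scope classical_set_scope.
Local Open Scope ring_scope.
Local Open Scope complex_scope.

(** Sequences indexed by the positive integers are represented by functions on
    [nat], the value at [n] being the term of rank [n.+1]. *)

Definition complex_of_pair (R : realType) (z : R * R) : R[i] := z.1 +i* z.2.

HB.instance Definition _ (R : realType) := isPointed.Build R[i] 0.

Section complex_measurable.
Context (R : realType).

(** The Borel sigma-algebra of C is transported from that of [R * R], which is
    the product sigma-algebra. *)
Definition complex_measurable : set (set R[i]) :=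
  [set A | measurable (@complex_of_pair R @^-1` A)].

Let complex_measurable0 : complex_measurable set0.
Proof. by rewrite /complex_measurable/= preimage_set0; exact: measurable0. Qed.

Let complex_measurableC A : complex_measurable A -> complex_measurable (~` A).
Proof.
by move=> mA; rewrite /complex_measurable/= -preimage_setC; exact: measurableC.
Qed.

Let complex_measurable_bigcup (F : (set R[i])^nat) :
  (forall i, complex_measurable (F i)) -> complex_measurable (\bigcup_i F i).
Proof.
move=> mF; rewrite /complex_measurable/= preimage_bigcup.
by apply: bigcup_measurable => k _; exact: mF.
Qed.

HB.instance Definition _ := @isMeasurable.Build default_measure_display R[i]
  complex_measurable complex_measurable0 complex_measurableC complex_measurable_bigcup.

End complex_measurable.

Definition lebesgue_measureC (R : realType) : set R[i] -> \bar R :=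
  pushforward (@lebesgue_measure R \x @lebesgue_measure R)%E
              (@complex_of_pair R).

Section complex_Lp.
Context (R : realType) (d : measure_display) (T : measurableType d).
Variable mu : {measure set T -> \bar R}.
Implicit Types f g : T -> R[i].

(** Elements of L^p are represented by measurable functions, not by classes
    modulo almost everywhere equality. *)
Definition LnormC (p : R) f : \bar R :=
  'N[mu]_(p%:E)[(fun x => (Normc.normc (f x))%:E)]%E.

Definition integralC f : R[i] :=
  Rintegral mu setT (fun x => complex.Re (f x)) +i*
  Rintegral mu setT (fun x => complex.Im (f x)).

Definition inner_L2 f g : R[i] := integralC (fun x => f x * (g x)^*).

Definition orthonormal_basis_L2 (e : nat -> {mfun T >-> R[i]}) : Prop :=
  [/\ forall n, (LnormC 2 (e n) < +oo)%E,
      forall m n, inner_L2 (e m) (e n) = (m == n)%:R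
    & forall f : {mfun T >-> R[i]}, (LnormC 2 f < +oo)%E ->
      forall eps : R, 0 < eps -> exists (N : nat) (a : nat -> R[i]),
        (LnormC 2 (fun x => f x - \sum_(k < N) a k * e k x)%R < eps%:E)%E].

End complex_Lp.

Definition in_l2 (R : realType) (c : nat -> R[i]) : Prop :=
  (\sum_(0 <= n <oo) (Normc.normc (c n) ^+ 2)%:E < +oo)%E.

Section random_series.
Context (R : realType) (dO : measure_display) (Omega : measurableType dO).
Variable P : probability Omega R.

Definition complex_gaussian (sigma : R) (X : {RV P >-> R[i]}) : Prop :=
  forall A : set R[i], measurable A ->
    distribution P X A = (\int[@lebesgue_measureC R]_(z in A)
      ((2 * pi * sigma ^+ 2)^-1 *
       expR (- (Normc.normc z ^+ 2 / (2 * sigma ^+ 2))))%:E)%E.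

Definition mutually_independent (d : measure_display) (T : measurableType d)
    (X : nat -> {RV P >-> T}) : Prop :=
  forall (J : {fset nat}) (A : nat -> set T),
    (forall j, j \in J -> measurable (A j)) ->
    P (\bigcap_(j in [set` J]) (X j @^-1` A j)) =
    (\prod_(j <- J) P (X j @^-1` A j))%E.

Context (dY : measure_display) (Y : measurableType dY).
Variable mu : {finite_measure set Y -> \bar R}.
Variables (g : nat -> {RV P >-> R[i]}) (e : nat -> {mfun Y >-> R[i]}).
Implicit Types (c : nat -> R[i]) (F : {mfun (Omega * Y)%type >-> R[i]}).

Definition partial_series c (N : nat) (x : Omega * Y) : R[i] :=
  \sum_(n < N) g n x.1 * c n * e n x.2.

Definition is_random_series c F : Prop :=
  (LnormC (P \x mu)%E 2 F < +oo)%E /\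
  LnormC (P \x mu)%E 2 (fun x => partial_series c N x - F x) @[N --> \oo]
    --> 0%E.

(** A representative of the limit in L^2(P \x mu) of the partial sums; the value
    [cst 0] is only used when there is no limit, which does not happen for a
    square summable [c] when [g] and [e] are as in the theorem. *)
Definition random_series c : {mfun (Omega * Y)%type >-> R[i]} :=
  xget (cst 0 : {mfun (Omega * Y)%type >-> R[i]}) [set F | is_random_series c F].

End random_series.

(* Main.v *)
Require Import Defs.
From HB Require Import structures.
From mathcomp Require Import all_boot all_order all_algebra.
From mathcomp Require Import complex finmap.
From mathcomp Require Import all_classical all_reals all_analysis.
From mathcomp Require Import measurable_realfun.
From mathcomp Require Import ring lra.
Import Order.TTheory GRing.Theory Num.Theory.
Import numFieldNormedType.Exports.
Local Open Scope classical_set_scope.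
Local Open Scope ring_scope.

Set Implicit Arguments.
Unset Strict Implicit.
Unset Printing Implicit Defensive.

(** The proof rests on exponential moments. If the [g n] are independent standard
    complex Gaussian variables, then the real part of [\sum_(n < N) g n * a n] has
    the moment generating function of a real Gaussian variable whose variance is
    [s ^+ 2 = \sum_(n < N) cabs (a n) ^+ 2] ([gauss_sum_mgf]). Two facts about the
    size of such a sum follow, and they are applied at each fixed [y] of [Y], with
    [a n = c n * e n y].

    The first one is that the moment of order [p] is at most a constant times
    [s `^ p] ([gauss_sum_moment]). If the [L^p] norms of the [e n] are bounded, then
    integrating over [Y] and applying the power mean inequality with the weights
    [cabs (c n) ^+ 2] bounds the [L^p] norms of the partial sums on the product
    space, uniformly in [N] ([partial_series_Lp_bounded]). The bound passes to the
    limit by truncation ([random_series_Lp]), and Fubini's theorem gives the almost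
    sure finiteness of the norm of the series.

    The second one is an anticoncentration property: on an event of probability
    close to one a sum cannot be small compared with [s], nor can any variable
    close to it in mean square ([gauss_sum_anticoncentration]). If the norm of the
    series is almost surely finite, it is bounded by some [M] on an event [B] of
    probability as close to one as desired. At almost every [y] the series is
    arbitrarily close in mean square to some partial sums, by Fatou's lemma; hence
    [cabs (c n * e n y) `^ p] is at most a constant times the expectation over [B]
    of the [p]-th power of the series at [y]. Integrating over [Y] shows that
    [cabs (c n)] times the norm of [e n] is bounded uniformly in [n]
    ([series_term_bound]). Were the norms of the [e n] unbounded, coefficients as
    large as [2 ^- k.+1] could be placed on vectors of norm larger than
    [4 ^ k.+1], with a finite sum of the coefficients, which contradicts this bound
    ([basis_norms_bounded]). For these coefficients the limit of the partial sums
    does exist ([random_series_exists]). *)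

(** * Complex absolute value and measurability *)

Notation cabs := Normc.normc.

Section complex_absolute_value.
Context (R : realType).
Implicit Types z w : R[i].

Lemma cabsE z : cabs z = Num.sqrt (complex.Re z ^+ 2 + complex.Im z ^+ 2).
Proof. by case: z. Qed.

Lemma cabs_ge0 z : 0 <= cabs z.
Proof. by rewrite cabsE sqrtr_ge0. Qed.

Lemma sqr_cabs z : cabs z ^+ 2 = complex.Re z ^+ 2 + complex.Im z ^+ 2.
Proof. by rewrite cabsE sqr_sqrtr// addr_ge0 ?sqr_ge0. Qed.

Lemma cabs0 : cabs (0 : R[i]) = 0.
Proof. exact: Normc.normc0. Qed.

Lemma cabsM z w : cabs (z * w) = cabs z * cabs w.
Proof. exact: Normc.normcM. Qed.

Lemma cabs_sum n (f : 'I_n -> R[i]) :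
  cabs (\sum_(i < n) f i) <= \sum_(i < n) cabs (f i).
Proof.
elim/big_ind2 : _ => [|x1 x2 y1 y2 h1 h2|//]; first by rewrite cabs0.
by apply: (le_trans (le_normcD _ _)); exact: lerD.
Qed.

Lemma cabs_real (x : R) : cabs x%:C%C = `|x|.
Proof. by rewrite cabsE/= expr0n/= addr0 sqrtr_sqr. Qed.

Lemma Re_le_cabs z : complex.Re z <= cabs z.
Proof.
rewrite cabsE (le_trans (ler_norm _))// -sqrtr_sqr ler_wsqrtr//.
by rewrite lerDl sqr_ge0.
Qed.

Lemma cabs_le_ReIm z : cabs z <= `|complex.Re z| + `|complex.Im z|.
Proof.
rewrite cabsE -[leRHS]ger0_norm ?addr_ge0// -sqrtr_sqr ler_wsqrtr//.
rewrite sqrrD !real_normK ?num_real// -addrA lerD2l lerDr.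
by rewrite mulrn_wge0// mulr_ge0.
Qed.

Lemma complex_of_ReIm z : z = complex_of_pair (complex.Re z, complex.Im z).
Proof. by case: z. Qed.

End complex_absolute_value.

Section complex_measurability.
Context (R : realType).

Lemma measurable_complex_of_pair :
  measurable_fun [set: R * R] (@complex_of_pair R).
Proof. by move=> _ A mA; rewrite setTI. Qed.

Lemma measurable_Re : measurable_fun [set: R[i]] (@complex.Re R).
Proof.
move=> _ A mA; rewrite setTI; rewrite /measurable/= /complex_measurable/=.
by rewrite -[X in measurable X]setTI; exact: measurable_fst.
Qed.

Lemma measurable_Im : measurable_fun [set: R[i]] (@complex.Im R).
Proof.
move=> _ A mA; rewrite setTI; rewrite /measurable/= /complex_measurable/=.
by rewrite -[X in measurable X]setTI; exact: measurable_snd.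
Qed.

Lemma measurable_cabs : measurable_fun [set: R[i]] (fun z => cabs z : R).
Proof.
rewrite (_ : (fun z => _) =
    fun z => Num.sqrt (complex.Re z ^+ 2 + complex.Im z ^+ 2)); last first.
  by apply/funext => z; rewrite cabsE.
apply: (@measurableT_comp _ _ _ _ _ _ (@Num.sqrt R)).
  by apply: (@continuous_measurable_fun R); exact: sqrt_continuous.
by apply: measurable_funD; apply: measurable_funX;
  [exact: measurable_Re|exact: measurable_Im].
Qed.

Context d (T : measurableType d).
Implicit Types f g : T -> R[i].

Lemma measurable_complexP f : measurable_fun [set: T] f <->
  measurable_fun [set: T] (fun x => complex.Re (f x)) /\
  measurable_fun [set: T] (fun x => complex.Im (f x)).
Proof.
split=> [mf|[mR mI]].
  split; [exact: measurableT_comp measurable_Re mf|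
          exact: measurableT_comp measurable_Im mf].
rewrite (_ : f = @complex_of_pair R \o
    (fun x => (complex.Re (f x), complex.Im (f x)))); last first.
  by apply/funext => x /=; rewrite -complex_of_ReIm.
apply: measurableT_comp; first exact: measurable_complex_of_pair.
exact: measurable_fun_pair.
Qed.

Lemma measurable_complexD f g : measurable_fun [set: T] f ->
  measurable_fun [set: T] g -> measurable_fun [set: T] (fun x => f x + g x).
Proof.
move=> /measurable_complexP[fR fI] /measurable_complexP[gR gI].
apply/measurable_complexP; split.
  rewrite [X in measurable_fun _ X](_ : _ = fun x =>
    complex.Re (f x) + complex.Re (g x)); first exact: measurable_funD.
  by apply/funext => x; case: (f x) => ? ?; case: (g x).
rewrite [X in measurable_fun _ X](_ : _ = fun x =>
  complex.Im (f x) + complex.Im (g x)); first exact: measurable_funD.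
by apply/funext => x; case: (f x) => ? ?; case: (g x).
Qed.

Lemma measurable_complexM f g : measurable_fun [set: T] f ->
  measurable_fun [set: T] g -> measurable_fun [set: T] (fun x => f x * g x).
Proof.
move=> /measurable_complexP[fR fI] /measurable_complexP[gR gI].
apply/measurable_complexP; split.
  rewrite [X in measurable_fun _ X](_ : _ = fun x =>
    complex.Re (f x) * complex.Re (g x) - complex.Im (f x) * complex.Im (g x)).
    by apply: measurable_funB; exact: measurable_funM.
  by apply/funext => x; case: (f x) => ? ?; case: (g x).
rewrite [X in measurable_fun _ X](_ : _ = fun x =>
  complex.Re (f x) * complex.Im (g x) + complex.Im (f x) * complex.Re (g x)).
  by apply: measurable_funD; exact: measurable_funM.
by apply/funext => x; case: (f x) => ? ?; case: (g x).
Qed.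

Lemma measurable_complexB f g : measurable_fun [set: T] f ->
  measurable_fun [set: T] g -> measurable_fun [set: T] (fun x => f x - g x).
Proof.
move=> mf mg.
rewrite (_ : (fun x => _) = (fun x => f x + (fun=> -1) x * g x)).
  by apply: measurable_complexD => //; exact: measurable_complexM.
by apply/funext => x; rewrite mulN1r.
Qed.

Lemma measurable_complex_sum N (f : nat -> T -> R[i]) :
  (forall n, measurable_fun [set: T] (f n)) ->
  measurable_fun [set: T] (fun x => \sum_(n < N) f n x).
Proof.
move=> mf; elim: N => [|N ih].
  by rewrite (_ : (fun x => _) = cst 0)//; apply/funext => x; rewrite big_ord0.
rewrite (_ : (fun x => _) = (fun x => \sum_(n < N) f n x + f N x)).
  exact: measurable_complexD.
by apply/funext => x; rewrite big_ord_recr.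
Qed.

Lemma measurable_fun_cabs f : measurable_fun [set: T] f ->
  measurable_fun [set: T] (fun x => cabs (f x)).
Proof. exact: measurableT_comp measurable_cabs. Qed.

Lemma measurable_cabs_powR f p : measurable_fun [set: T] f ->
  measurable_fun [set: T] (fun x => (cabs (f x) `^ p)%:E).
Proof.
move=> mf; apply/measurable_EFinP.
by apply: (measurableT_comp (measurable_powR p)); exact: measurable_fun_cabs.
Qed.

End complex_measurability.

(** * Image of a measure with a density *)

Section density.
Local Open Scope ereal_scope.
Context d d' (S : measurableType d) (T : measurableType d') (R : realType).
Variables (nu : {measure set T -> \bar R}) (mu : {measure set S -> \bar R}).
Variables (phi : S -> T) (h : S -> R).
Hypotheses (mphi : measurable_fun [set: S] phi) (mh : measurable_fun [set: S] h).
Hypothesis h0 : forall x, (0 <= h x)%R.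
Hypothesis nuE : forall A, measurable A ->
  nu A = \int[mu]_(x in phi @^-1` A) (h x)%:E.

Import HBNNSimple.

Let integral_density_nnsfun (f : {nnsfun T >-> R}) :
  \int[nu]_y (f y)%:E = \int[mu]_x (f (phi x) * h x)%:E.
Proof.
under [LHS]eq_integral do rewrite fimfunE -fsumEFin//.
rewrite [LHS]ge0_integral_fsum//; last 2 first.
  - by move=> r; exact/measurable_EFinP/measurableT_comp.
  - by move=> n x _; rewrite EFinM nnfun_muleindic_ge0.
have mind r : measurable_fun [set: S] (fun x => \1_(f @^-1` [set r]) (phi x) : R).
  apply: (@measurableT_comp _ _ _ _ _ _ (\1_(f @^-1` [set r]) : T -> R)) => //.
transitivity (\int[mu]_x (\sum_(r \in range f)
    (r * (\1_(f @^-1` [set r]) (phi x) * h x))%:E)); last first.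
  apply: eq_integral => x _; rewrite fsumEFin//.
  congr EFin; rewrite [in RHS]fimfunE mulr_fsuml//.
  by apply: eq_fsbigr => r _; rewrite mulrA.
rewrite ge0_integral_fsum//; last 2 first.
- move=> r; apply/measurable_EFinP; apply: measurable_funM => //.
  by apply: measurable_funM.
- move=> r x _; rewrite mulrA EFinM mule_ge0 ?lee_fin//.
  by rewrite -lee_fin EFinM nnfun_muleindic_ge0.
apply: eq_fsbigr => r; rewrite inE => -[y _ fyr].
under [LHS]eq_integral do rewrite EFinM.
under [RHS]eq_integral do rewrite EFinM.
have r0 : (0 <= r)%R by rewrite -fyr.
rewrite !ge0_integralZl_EFin//; last 3 first.
- by move=> x _; rewrite lee_fin mulr_ge0.
- by apply/measurable_EFinP; apply: measurable_funM.
- exact/measurable_EFinP.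
congr (_ * _); rewrite integral_indic// setIT nuE// [LHS]integral_mkcond.
apply: eq_integral => x _; rewrite patchE indicE.
rewrite (_ : (x \in _) = (phi x \in f @^-1` [set r]))//.
by case: (phi x \in _); rewrite ?mul1r ?mul0r.
Qed.

(** The hypothesis [nuE] says that [nu] is the image under [phi] of the measure
    with density [h] with respect to [mu]; it is the case of an indicator, from
    which one goes to simple functions by linearity and to nonnegative functions
    by monotone convergence. *)
Lemma integral_density_transfer (f : T -> \bar R) :
  measurable_fun [set: T] f -> (forall y, 0 <= f y) ->
  \int[nu]_y f y = \int[mu]_x (f (phi x) * (h x)%:E).
Proof.
move=> mf f0; pose f_ := nnsfun_approx measurableT mf.
transitivity (limn (fun n => \int[nu]_y (f_ n y)%:E)).
  rewrite -monotone_convergence//=.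
  - apply: eq_integral => x /[!inE] xD; apply/esym/cvg_lim => //=.
    exact: cvg_nnsfun_approx.
  - by move=> n; exact/measurable_EFinP.
  - by move=> n x _; rewrite lee_fin.
  - by move=> x _ a b ab; rewrite lee_fin//; exact/lefP/nd_nnsfun_approx.
under eq_fun do rewrite integral_density_nnsfun.
rewrite -monotone_convergence//=.
- apply: eq_integral => x _; apply/cvg_lim => //=.
  under eq_fun do rewrite EFinM.
  apply: cvgeZr => //.
  by apply: cvg_nnsfun_approx.
- move=> n; apply/measurable_EFinP; apply: measurable_funM => //.
  exact: measurableT_comp.
- by move=> n x _; rewrite lee_fin mulr_ge0.
- move=> x _ a b ab; rewrite lee_fin ler_wpM2r//.
  exact/lefP/nd_nnsfun_approx.
Qed.

End density.

(** * Expectation of products of independent variables *)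

Section independence.
Context (R : realType) dO (Omega : measurableType dO) (P : probability Omega R).
Context d (T : measurableType d) (X : nat -> {RV P >-> T}).
Hypothesis indepX : mutually_independent X.

Let independent_indic N (A : nat -> set T) (m : nat -> R) :
  (forall n, measurable (A n)) ->
  (forall n, P (X n @^-1` A n) = (m n)%:E) ->
  (\int[P]_w (\prod_(n < N) \1_(A n) (X n w))%:E = (\prod_(n < N) m n)%:E)%E.
Proof.
move=> mA mE.
have mXA n : measurable (X n @^-1` A n).
  by rewrite -[X in measurable X]setTI; apply: measurable_funP.
pose J := [fset n in iota 0 N]%fset.
have := @indepX J A (fun n _ => mA n).
rewrite (eq_bigr (fun n => (m n)%:E)); last by move=> n _; rewrite mE.
have prodJ (F : nat -> R) : \prod_(n <- J) F n = \prod_(n < N) F n.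
  rewrite -(big_mkord xpredT F) /index_iota subn0.
  apply: perm_big; apply: uniq_perm; rewrite ?iota_uniq//.
  by move=> n; rewrite /J inE.
rewrite prodEFin prodJ => <-.
rewrite -[X in _ = P X]setIT -integral_indic//; last first.
  by apply: fin_bigcap_measurable => //; exact: finite_fset.
apply: eq_integral => w _; congr EFin.
rewrite -(prodJ (fun n => \1_(A n) (X n w))) [RHS]indicE.
have [|] := boolP (w \in _).
  rewrite inE => /= wJ; rewrite big_seq big1// => n nJ.
  by rewrite indicE mem_set//; exact: wJ.
move/negP; rewrite inE => /= /existsNP[n /not_implyP[nJ XA]].
rewrite (big_rem n)//= indicE.
by rewrite memNset// mul0r.
Qed.

(** The indicators are replaced by functions one rank at a time. The formula with
    an arbitrary indicator at rank [k] says that the measure whose density is the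
    product of the other factors has, up to a constant, the law of [X k] as
    image; integrating [f k] against this image gives the formula with [f k] at
    rank [k]. *)
Let independent_prod_rec k N (f : nat -> T -> R) (m : nat -> R) :
  (forall n, measurable_fun [set: T] (f n)) -> (forall n x, 0 <= f n x) ->
  (forall n, (k <= n)%N -> exists2 A, measurable A & f n = \1_A) ->
  (forall n, \int[P]_w (f n (X n w))%:E = (m n)%:E)%E ->
  (\int[P]_w (\prod_(n < N) f n (X n w))%:E = (\prod_(n < N) m n)%:E)%E.
Proof.
elim: k f m => [|k ih] f m mf f0 findic fm.
  have /choice[A AP] : forall n, exists A, measurable A /\ f n = \1_A.
    by move=> n; have [A mA fA] := findic n isT; exists A.
  rewrite -(@independent_indic N A m).
  - apply: eq_integral => w _; congr EFin; apply: eq_bigr => n _.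
    by rewrite (AP n).2.
  - by move=> n; exact: (AP n).1.
  - move=> n; rewrite -fm; under eq_integral do rewrite (AP n).2.
    rewrite -[in LHS](setIT (_ @^-1` _)) -integral_indic//.
    rewrite -[X in measurable X]setTI; apply: measurable_funP => //.
    exact: (AP n).1.
pose f' A n := if n == k then \1_A : T -> R else f n.
pose m' A n := if n == k then fine (P (X k @^-1` A)) else m n.
have mXA A : measurable A -> measurable (X k @^-1` A).
  by move=> mA; rewrite -[X in measurable X]setTI; apply: measurable_funP.
have ihA A : measurable A ->
  (\int[P]_w (\prod_(n < N) f' A n (X n w))%:E = (\prod_(n < N) m' A n)%:E)%E.
  move=> mA; apply: ih => [n|n x|n kn|n].
  - by rewrite /f'; case: ifPn => // _; exact: measurable_indic.
  - by rewrite /f'; case: ifPn.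
  - rewrite /f'; case: ifPn => [_|nk]; first by exists A.
    by apply: findic; rewrite ltn_neqAle eq_sym nk.
  - rewrite /f' /m'; case: ifPn => [/eqP ->|_]; last exact: fm.
    rewrite fineK ?fin_num_measure//; last exact: mXA.
    by rewrite -[in RHS](setIT (_ @^-1` _)) -integral_indic//; exact: mXA.
(* A factor of rank at least [N] does not occur in the products. *)
have [Nk|kN] := leqP N k.
  rewrite -[RHS](_ : (\prod_(n < N) m' setT n)%:E = _)%E; last first.
    by congr EFin; apply: eq_bigr => n _; rewrite /m' ltn_eqF// (leq_trans _ Nk).
  rewrite -ihA//; apply: eq_integral => w _; congr EFin; apply: eq_bigr => n _.
  by rewrite /f' ltn_eqF// (leq_trans _ Nk).
pose k' := Ordinal kN.
pose H w := \prod_(n < N | n != k') f n (X n w).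
pose c := \prod_(n < N | n != k') m n.
have m0 n : 0 <= m n.
  by rewrite -lee_fin -fm; apply: integral_ge0 => w _; rewrite lee_fin.
have c0 : 0 <= c by rewrite prodr_ge0.
have HE A : measurable A ->
    (\int[P]_w (\1_A (X k w) * H w)%:E = c%:E * P (X k @^-1` A))%E.
  move=> mA; have := ihA _ mA.
  rewrite (bigD1 k')//= {1}/m' eqxx mulrC EFinM fineK ?fin_num_measure//; last exact: mXA.
  rewrite (_ : \prod_(i < N | i != k') m' A i = c); last first.
    by apply: eq_bigr => n; rewrite -val_eqE /m' => /negPf ->.
  move=> <-; apply: eq_integral => w _; congr EFin.
  rewrite (bigD1 k')//= {1}/f' eqxx; congr (_ * _).
  by apply: eq_bigr => n; rewrite -val_eqE /f' => /negPf ->.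
have mH : measurable_fun setT H.
  rewrite /H.
  under eq_fun do rewrite -big_filter.
  apply: measurable_prod => n _ /=.
  by apply: (measurableT_comp (mf n)); exact: measurable_funP.
have H0 w : 0 <= H w by rewrite prodr_ge0.
transitivity (\int[P]_w ((f k (X k w))%:E * (H w)%:E))%E.
  by apply: eq_integral => w _; rewrite -EFinM (bigD1 k').
rewrite -(@integral_density_transfer _ _ _ _ _
   (mscale (NngNum c0) (distribution P (X k))) P (X k) H _ _ _ _ (EFin \o f k))//=.
- rewrite ge0_integral_mscale//=; last 2 first.
  + exact/measurable_EFinP.
  + by move=> x _; rewrite lee_fin.
  rewrite ge0_integral_distribution//=; last 2 first.
  + exact/measurable_EFinP.
  + by move=> y; rewrite lee_fin.
  rewrite fm -EFinM; congr EFin.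
  by rewrite (bigD1 k')//= mulrC.
- move=> A mA; rewrite /mscale/= /distribution/= /pushforward -HE//.
  rewrite [RHS]integral_mkcond; apply: eq_integral => w _.
  rewrite patchE indicE (_ : (w \in _) = (X k w \in A))//.
  by case: (_ \in _); rewrite ?mul1r ?mul0r.
- exact/measurable_EFinP.
- by move=> y; rewrite lee_fin.
Qed.

Lemma independent_prod N (f : nat -> T -> R) (m : nat -> R) :
  (forall n, measurable_fun [set: T] (f n)) -> (forall n x, 0 <= f n x) ->
  (forall n, \int[P]_w (f n (X n w))%:E = (m n)%:E)%E ->
  (\int[P]_w (\prod_(n < N) f n (X n w))%:E = (\prod_(n < N) m n)%:E)%E.
Proof.
move=> mf f0 fm.
pose f' n := if (n < N)%N then f n else \1_setT.
pose m' n := if (n < N)%N then m n else 1.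
have := @independent_prod_rec N N f' m'.
rewrite (_ : \prod_(n < N) m' n = \prod_(n < N) m n); last first.
  by apply: eq_bigr => n _; rewrite /m' ltn_ord.
move=> <-.
- apply: eq_integral => w _; congr EFin; apply: eq_bigr => n _.
  by rewrite /f' ltn_ord.
- by move=> n; rewrite /f'; case: ifP => // _; exact: measurable_indic.
- by move=> n x; rewrite /f'; case: ifP.
- by move=> n Nn; exists setT => //; rewrite /f' ltnNge Nn.
- move=> n; rewrite /f' /m'; case: ifP => // _.
  rewrite -(probability_setT P) -[X in _ = P X]setIT -integral_indic//.
Qed.

End independence.

(** * Exponential moments of complex Gaussian variables *)

Section gaussian.
Context (R : realType) dO (Omega : measurableType dO) (P : probability Omega R).
Implicit Types (X : {RV P >-> R[i]}) (a : R[i]).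

Lemma ReM (z w : R[i]) : complex.Re (z * w) =
  complex.Re z * complex.Re w - complex.Im z * complex.Im w.
Proof. by case: z w => ? ? []. Qed.

Let gauss_density (z : R[i]) : R :=
  (2 * pi * 1 ^+ 2)^-1 * expR (- (cabs z ^+ 2 / (2 * 1 ^+ 2))).

(** Completing the square: the density of the standard complex Gaussian law,
    tilted by an exponential, is a multiple of a product of two translated real
    Gaussian densities. *)
Let tilted_gauss_density a (x : R * R) :
  expR (complex.Re (complex_of_pair x * a)) * gauss_density (complex_of_pair x) =
  expR (cabs a ^+ 2 / 2) *
  (normal_pdf (complex.Re a) 1 x.1 * normal_pdf (- complex.Im a) 1 x.2).
Proof.
rewrite /gauss_density !normal_pdfE ?oner_eq0// /normal_fun ReM !sqr_cabs/=.
rewrite mulrCA [X in _ * X = _](_ : _ =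
  expR ((complex.Re a ^+ 2 + complex.Im a ^+ 2) / 2) *
  (expR (- (x.1 - complex.Re a) ^+ 2 / (1 ^+ 2 *+ 2)) *
   expR (- (x.2 - - complex.Im a) ^+ 2 / (1 ^+ 2 *+ 2)))); last first.
  by rewrite -!expRD; congr expR; field.
rewrite mulrCA; congr (_ * _).
rewrite [RHS]mulrACA; congr (_ * _).
rewrite /normal_peak -expr2 exprVn sqr_sqrtr.
  by rewrite expr1n mul1r mulr1 mulr_natl.
by rewrite expr1n mul1r mulrn_wge0// pi_ge0.
Qed.

Lemma gaussian_mgf X a : complex_gaussian 1 X ->
  (\int[P]_w (expR (complex.Re (X w * a)))%:E = (expR (cabs a ^+ 2 / 2))%:E)%E.
Proof.
move=> gX.
have mexp : measurable_fun [set: R[i]] (fun z => expR (complex.Re (z * a))).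
  apply: measurableT_comp => //.
  apply: (measurableT_comp (@measurable_Re R)).
  exact: measurable_complexM.
have mdens : measurable_fun [set: R[i]] gauss_density.
  apply: measurable_funM => //; apply: measurableT_comp => //.
  apply: measurableT_comp => //; apply: measurable_funM => //.
  by apply: measurable_funX; exact: measurable_cabs.
have dens0 z : 0 <= gauss_density z.
  by rewrite mulr_ge0 ?expR_ge0// invr_ge0 expr1n mulr1 mulr_ge0// pi_ge0.
have mcp := @measurable_complex_of_pair R.
have mden2 : measurable_fun setT (gauss_density \o @complex_of_pair R).
  exact: measurableT_comp.
rewrite -(@ge0_integral_distribution _ _ _ _ _ P X
  (fun z => (expR (complex.Re (z * a)))%:E))//; last exact/measurable_EFinP.
rewrite (@integral_density_transfer _ _ _ _ _ (distribution P X)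
  (@lebesgue_measure R \x @lebesgue_measure R)%E (@complex_of_pair R)
  (gauss_density \o @complex_of_pair R))//; last 3 first.
- by move=> x; exact: dens0.
- move=> A mA; apply: (etrans (gX A mA)).
  rewrite /lebesgue_measureC ge0_integral_pushforward//.
  + by apply: measurable_funTS; exact/measurable_EFinP.
  + by move=> z _; rewrite lee_fin; exact: dens0.
- exact/measurable_EFinP.
under eq_integral => x _ do rewrite /comp -EFinM tilted_gauss_density !EFinM.
have mpdf (m : R) : measurable_fun setT (fun x : R => (normal_pdf m 1 x)%:E).
  by apply/measurable_EFinP; exact: measurable_normal_pdf.
have mprod : measurable_fun setT (fun x : R * R =>
  ((normal_pdf (complex.Re a) 1 x.1)%:E *
   (normal_pdf (- complex.Im a) 1 x.2)%:E)%E).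
  by apply: emeasurable_funM;
    [exact: (measurableT_comp (mpdf _))|exact: (measurableT_comp (mpdf _))].
rewrite ge0_integralZl//; last first.
  by move=> x _; rewrite mule_ge0// lee_fin normal_pdf_ge0.
rewrite fubini_tonelli1//; last first.
  by move=> x; rewrite mule_ge0// lee_fin normal_pdf_ge0.
rewrite /fubini_F/=.
under eq_integral => x _.
  rewrite ge0_integralZl//; last 3 first.
  - exact: mpdf.
  - by move=> y _; rewrite lee_fin normal_pdf_ge0.
  - by rewrite lee_fin normal_pdf_ge0.
  rewrite integral_normal_pdf mule1.
  over.
by rewrite integral_normal_pdf mule1.
Qed.

End gaussian.

(** * Moments of Gaussian sums *)

Section pointwise_bounds.
Context (R : realType).
Implicit Types (p t : R) (z u : R[i]).

Lemma powR_le_expR p t : 0 < p -> 0 <= t -> t `^ p <= p `^ p * expR t.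
Proof.
move=> p0 t0; have tp0 : 0 <= t / p by rewrite divr_ge0// ltW.
rewrite -[in leLHS](divfK (lt0r_neq0 p0) t) mulrC powRM ?(ltW p0)//.
rewrite ler_wpM2l ?powR_ge0//.
rewrite -[in leRHS](divfK (lt0r_neq0 p0) t) expRM.
apply: ge0_ler_powR; rewrite ?nnegrE ?expR_ge0 ?(ltW p0)//.
by apply: le_trans (expR_ge1Dx _); rewrite lerDr.
Qed.

Definition fourth_roots : seq R[i] := [:: 1; -1; (0 +i* 1)%C; (0 -i* 1)%C].

Lemma cabs_fourth_roots u : u \in fourth_roots -> cabs u = 1.
Proof.
rewrite !inE => /or4P[] /eqP ->; rewrite cabsE/=.
- by rewrite expr0n/= addr0 expr1n sqrtr1.
- by rewrite oppr0 expr0n/= addr0 sqrrN expr1n sqrtr1.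
- by rewrite expr0n/= add0r expr1n sqrtr1.
- by rewrite expr0n/= add0r sqrrN expr1n sqrtr1.
Qed.

(** The largest of the numbers [Re z], [- Re z], [Im z] and [- Im z] is at least
    half of the absolute value of [z]. *)
Lemma cabs_powR_le_expR p z : 0 < p ->
  cabs z `^ p <= (2 * p) `^ p * \sum_(u <- fourth_roots) expR (complex.Re (z * u)).
Proof.
move=> p0.
set M := Num.max `|complex.Re z| `|complex.Im z|.
have M0 : 0 <= M by rewrite le_max normr_ge0.
have zM : cabs z <= 2 * M.
  apply: (le_trans (cabs_le_ReIm z)); rewrite mulr_natl mulr2n.
  by apply: lerD; rewrite le_max lexx ?orbT.
apply: (@le_trans _ _ ((2 * M) `^ p)).
  by apply: ge0_ler_powR; rewrite ?nnegrE ?cabs_ge0 ?mulr_ge0 ?(ltW p0).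
rewrite [in leLHS]powRM// powRM ?(ltW p0)// -mulrA ler_wpM2l ?powR_ge0//.
apply: (le_trans (powR_le_expR p0 M0)); rewrite ler_wpM2l ?powR_ge0//.
rewrite !big_cons big_nil addr0 !ReM/=.
rewrite !(mulr1, mulr0, mulrN1, subr0, sub0r, oppr0, opprK, mulrN, addr0).
have e0 x : 0 <= expR x :> R by exact: expR_ge0.
have := e0 (complex.Re z); have := e0 (- complex.Re z).
have := e0 (complex.Im z); have := e0 (- complex.Im z).
rewrite /M /Num.max; case: ifPn => _.
  by case: (ger0P (complex.Im z)) => _; lra.
by case: (ger0P (complex.Re z)) => _; lra.
Qed.

End pointwise_bounds.

Lemma sum_sqr_cabs_normalized (R : realType) N (a : nat -> R[i])
    (s := Num.sqrt (\sum_(n < N) cabs (a n) ^+ 2)) : 0 < s ->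
  \sum_(n < N) cabs (a n * (s^-1)%:C%C) ^+ 2 = 1.
Proof.
move=> s0; have S0 : 0 <= \sum_(n < N) cabs (a n) ^+ 2.
  by apply: sumr_ge0 => n _; exact: sqr_ge0.
under eq_bigr do rewrite cabsM exprMn cabs_real real_normK ?num_real//.
rewrite -mulr_suml -[X in X * _](sqr_sqrtr S0) -/s exprVn divff//.
by rewrite sqrf_eq0 gt_eqF.
Qed.

Section gaussian_sums.
Context (R : realType) dO (Omega : measurableType dO) (P : probability Omega R).
Variable g : nat -> {RV P >-> R[i]}.
Hypotheses (indepg : mutually_independent g).
Hypothesis gaussg : forall n, complex_gaussian 1 (g n).
Implicit Types a : nat -> R[i].

Definition gauss_sum N a (w : Omega) : R[i] := \sum_(n < N) g n w * a n.

Lemma gauss_sumZ N a u w : gauss_sum N a w * u = gauss_sum N (fun n => a n * u) w.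
Proof. by rewrite mulr_suml; apply: eq_bigr => n _; rewrite mulrA. Qed.

Lemma measurable_gauss_sum N a : measurable_fun setT (gauss_sum N a).
Proof.
apply: (@measurable_complex_sum R _ _ N (fun n w => g n w * a n)) => n.
by apply: measurable_complexM => //; exact: measurable_funP.
Qed.

Lemma measurable_expR_Re (f : Omega -> R[i]) : measurable_fun setT f ->
  measurable_fun setT (fun w => expR (complex.Re (f w))).
Proof.
move=> mf; apply: measurableT_comp => //.
exact: (measurableT_comp (@measurable_Re R)).
Qed.

Lemma gauss_sum_mgf N a :
  (\int[P]_w (expR (complex.Re (gauss_sum N a w)))%:E =
   (expR ((\sum_(n < N) cabs (a n) ^+ 2) / 2))%:E)%E.
Proof.
rewrite mulr_suml expR_sum -(@independent_prod _ _ _ _ _ _ g indepg N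
  (fun n z => expR (complex.Re (z * a n)))
  (fun n => expR (cabs (a n) ^+ 2 / 2))).
- apply: eq_integral => w _; congr EFin; rewrite -expR_sum; congr expR.
  rewrite /gauss_sum; elim/big_ind2 : _ => //= z1 x1 z2 x2 <- <-.
  by case: x1 x2 => ? ? [].
- move=> n; apply: measurableT_comp => //.
  by apply: (measurableT_comp (@measurable_Re R)); exact: measurable_complexM.
- by move=> n z; exact: expR_ge0.
- by move=> n; exact: gaussian_mgf.
Qed.

Lemma gauss_sum_mgfZ N a u : \sum_(n < N) cabs (a n) ^+ 2 = 1 ->
  (\int[P]_w (expR (complex.Re (gauss_sum N a w * u)))%:E =
   (expR (cabs u ^+ 2 / 2))%:E)%E.
Proof.
move=> a1; under eq_integral do rewrite gauss_sumZ.
rewrite gauss_sum_mgf; congr ((expR (_ / 2))%:E).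
by under eq_bigr do rewrite cabsM exprMn; rewrite -mulr_suml a1 mul1r.
Qed.

(** By homogeneity the variance may be supposed to be one; the exponential
    moments of the sum are then explicit. *)
Lemma gauss_sum_moment p : 0 < p -> exists2 K, 0 <= K & forall N a,
  (\int[P]_w (cabs (gauss_sum N a w) `^ p)%:E <=
   (K * (\sum_(n < N) cabs (a n) ^+ 2) `^ (p / 2))%:E)%E.
Proof.
move=> p0; pose C : R := (2 * p) `^ p.
exists (C * (4 * expR (1 / 2))); first by rewrite !mulr_ge0 ?powR_ge0 ?expR_ge0.
have normalized N a : \sum_(n < N) cabs (a n) ^+ 2 = 1 ->
    (\int[P]_w (cabs (gauss_sum N a w) `^ p)%:E <= (C * (4 * expR (1 / 2)))%:E)%E.
  move=> a1.
  have mS u : measurable_fun setT (fun w => expR (complex.Re (gauss_sum N a w * u))).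
    apply: measurable_expR_Re; apply: measurable_complexM => //.
    exact: measurable_gauss_sum.
  apply: (@le_trans _ _ (\int[P]_w (C%:E * \sum_(u <- fourth_roots R)
      (expR (complex.Re (gauss_sum N a w * u)))%:E))%E).
    apply: ge0_le_integral => //.
    - by move=> w _; rewrite lee_fin powR_ge0.
    - by apply: measurable_cabs_powR; exact: measurable_gauss_sum.
    - apply: emeasurable_funM => //; apply: emeasurable_sum => u.
      exact/measurable_EFinP.
    - move=> w _; rewrite sumEFin -EFinM lee_fin.
      exact: cabs_powR_le_expR.
  rewrite ge0_integralZl_EFin//; last 3 first.
  - by move=> w _; apply: sume_ge0 => u _; rewrite lee_fin expR_ge0.
  - by apply: emeasurable_sum => u; exact/measurable_EFinP.
  - exact: powR_ge0.
  rewrite ge0_integral_sum//; last by move=> u; exact/measurable_EFinP.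
  rewrite EFinM lee_wpmul2l ?lee_fin ?powR_ge0//.
  rewrite (eq_big_seq (fun=> (expR (1 / 2))%:E)); last first.
    by move=> u /cabs_fourth_roots u1; rewrite gauss_sum_mgfZ// u1 expr1n.
  by rewrite !big_cons big_nil addr0 -!EFinD lee_fin; lra.
move=> N a; set S2 := \sum_(n < N) _.
have S20 : 0 <= S2 by apply: sumr_ge0 => n _; exact: sqr_ge0.
have [s0|s0] := ltP 0 (Num.sqrt S2); last first.
  have S2E : S2 = 0.
    by apply/eqP; rewrite eq_le S20 andbT -sqrtr_eq0 eq_le s0 sqrtr_ge0.
  have a0 (n : 'I_N) : a n = 0.
    have /eqP := S2E; rewrite psumr_eq0; last by move=> i _; exact: sqr_ge0.
    move=> /allP/(_ n); rewrite mem_index_enum => /(_ isT)/=.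
    by rewrite sqrf_eq0 => /eqP; exact: Normc.eq0_normc.
  rewrite (eq_integral (cst 0%E)).
    by rewrite integral0 lee_fin !mulr_ge0 ?powR_ge0 ?expR_ge0.
  move=> w _; rewrite /gauss_sum big1 ?cabs0 ?powR0 ?gt_eqF//.
  by move=> n _; rewrite a0 mulr0.
set s := Num.sqrt S2 in s0.
have -> : S2 `^ (p / 2) = s `^ p.
  by rewrite /s -powR12_sqrt// -powRrM [X in _ = _ `^ X]mulrC.
rewrite (eq_integral (fun w =>
  ((s `^ p)%:E * (cabs (gauss_sum N (fun n => a n * (s^-1)%:C%C) w) `^ p)%:E)%E)).
  rewrite ge0_integralZl_EFin ?powR_ge0//; last 2 first.
  - by move=> w _; rewrite lee_fin powR_ge0.
  - by apply: measurable_cabs_powR; exact: measurable_gauss_sum.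
  rewrite muleC EFinM lee_wpmul2r ?lee_fin ?powR_ge0//.
  by apply: normalized; exact: sum_sqr_cabs_normalized.
move=> w _; rewrite -gauss_sumZ cabsM cabs_real -EFinM; congr EFin.
rewrite -powRM ?mulr_ge0 ?cabs_ge0 ?(ltW s0)// ger0_norm ?invr_ge0 ?(ltW s0)//.
by rewrite mulrCA divff ?gt_eqF// mulr1.
Qed.

End gaussian_sums.

(** * Anticoncentration of Gaussian sums *)

Section gaussian_lower_bound.
Context (R : realType).

(** The boolean [b] stands for the membership in the event on which [z] is
    controlled. If [x] is larger than [1 / 5], then so is the absolute value of
    [t], and either [z] or [t - z] has absolute value at least [1 / 10]; these
    lower bounds are worth at least [expR x] as long as [expR x] is less than
    [eta^-1]. The last term takes care of larger values of [expR x]. *)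
Let expR_le_split (p eta : R) (b : bool) (t z : R[i]) (x := complex.Re t) :
  0 < p -> 0 < eta ->
  expR x <= 5 / 4 + eta^-1 * (10 `^ p * (b%:R * cabs z `^ p)
                              + 10 `^ 2 * cabs (t - z) `^ 2)
            + eta^-1 * (~~ b)%:R + eta * expR (2 * x).
Proof.
move=> p0 eta0.
have A0 : 0 <= 10 `^ p * (b%:R * cabs z `^ p) by rewrite !mulr_ge0 ?powR_ge0.
have B0 : 0 <= 10 `^ 2 * cabs (t - z) `^ 2 by rewrite !mulr_ge0 ?powR_ge0.
have C0 : 0 <= eta^-1 * (~~ b)%:R by rewrite mulr_ge0// invr_ge0 ltW.
have D0 : 0 <= eta * expR (2 * x) by rewrite mulr_ge0 ?expR_ge0 ?(ltW eta0).
have AB0 : 0 <= eta^-1 * (10 `^ p * (b%:R * cabs z `^ p)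
                              + 10 `^ 2 * cabs (t - z) `^ 2).
  by rewrite mulr_ge0 ?invr_ge0 ?(ltW eta0) ?addr_ge0.
have [x5|x5] := leP x (1 / 5).
  suff : expR x <= 5 / 4 by lra.
  apply: (@le_trans _ _ (expR (1 / 5))); first by rewrite ler_expR.
  rewrite -[leLHS]invrK -expRN invf_ple ?posrE ?expR_gt0 ?divr_gt0//.
  by apply: le_trans (expR_ge1Dx _); lra.
have [ex|ex] := leP eta^-1 (expR x).
  suff : expR x <= eta * expR (2 * x) by lra.
  rewrite mulr_natl mulr2n expRD mulrA ler_peMl ?expR_ge0//.
  by rewrite -ler_pdivrMl// mulr1.
have eV0 : 0 <= eta^-1 by rewrite invr_ge0 ltW.
case: b A0 C0 AB0 => /= A0 C0 AB0; last by rewrite mulr1; lra.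
suff AB1 : 1 <= 10 `^ p * (1 * cabs z `^ p) + 10 `^ 2 * cabs (t - z) `^ 2.
  have := ler_wpM2l eV0 AB1; rewrite mulr1; lra.
have tzx : 1 / 5 <= cabs z + cabs (t - z).
  apply: le_trans (le_normcD _ _); rewrite addrC subrK.
  by apply: le_trans (Re_le_cabs _); exact: ltW.
have one_le (y q : R) : 0 <= q -> 1 / 10 <= y -> 1 <= 10 `^ q * y `^ q.
  move=> q0 y10; have y0 : 0 <= y by lra.
  rewrite -powRM//.
  rewrite [leLHS](_ : 1 = 1 `^ q); last by rewrite powR1.
  apply: ge0_ler_powR; rewrite ?nnegrE//; lra.
rewrite mul1r; rewrite mul1r in A0.
have [z10|z10] := leP (1 / 10) (cabs z).
  by have := @one_le (cabs z) p (ltW p0) z10; lra.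
have tz10 : 1 / 10 <= cabs (t - z) by lra.
by have := @one_le (cabs (t - z)) 2 (ler0n _ _) tz10; lra.
Qed.

Let cabsZ_powR_le (q u s : R) (z : R[i]) : 0 <= q -> 0 < u -> u <= s ->
  cabs (z * (s^-1)%:C%C) `^ q <= u `^ (- q) * cabs z `^ q.
Proof.
move=> q0 u0 us; have s0 : 0 < s by apply: lt_le_trans us.
rewrite cabsM cabs_real ger0_norm ?invr_ge0 ?(ltW s0)//.
rewrite powRM ?cabs_ge0 ?invr_ge0 ?(ltW s0)//.
rewrite mulrC ler_wpM2r ?powR_ge0// -mulN1r powRrM powR_inv1 ?(ltW u0)//.
by apply: ge0_ler_powR; rewrite ?nnegrE ?invr_ge0 ?(ltW s0) ?(ltW u0)// lef_pV2.
Qed.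

Context dO (Omega : measurableType dO) (P : probability Omega R).
Variable g : nat -> {RV P >-> R[i]}.
Hypotheses (indepg : mutually_independent g).
Hypothesis gaussg : forall n, complex_gaussian 1 (g n).

(** The expectation of [expR x], where [x] is the real part of the normalized sum,
    is [expR (1 / 2)], hence at least [3 / 2], whereas the pointwise bound
    integrates to [5 / 4] plus two terms equal to [1 / 16] at most plus a multiple
    of the two terms of the conclusion. The conclusion contains [u] instead of the
    standard deviation of the sum, so that neither the constants nor the powers
    of [u] depend on [N]. *)
Lemma gauss_sum_anticoncentration (p : R) : 0 < p ->
  exists K eps : R, [/\ 0 < K, 0 < eps &
    forall N (a : nat -> R[i]) (u : R) B (Z : Omega -> R[i]),
    measurable B -> (P (~` B) <= eps%:E)%E -> measurable_fun setT Z ->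
    0 < u -> u ^+ 2 <= \sum_(n < N) cabs (a n) ^+ 2 ->
    (1 <= K%:E * ((u `^ (- p))%:E * \int[P]_(w in B) (cabs (Z w) `^ p)%:E +
       (u `^ (- 2))%:E *
       \int[P]_w (cabs (gauss_sum g N a w - Z w) `^ 2)%:E))%E].
Proof.
move=> p0.
(* With this [eta] the term [eta * expR (2 * x)] integrates to [1 / 16], and the
   term supported by the complement of [B] to at most [eta^-1 * eps = 1 / 16]. *)
pose eta : R := (16 * expR 2)^-1.
have eta0 : 0 < eta by rewrite invr_gt0 mulr_gt0 ?expR_gt0.
have etaVE : eta^-1 = 16 * expR 2 by rewrite invrK.
pose L : R := eta^-1 * (10 `^ p + 10 `^ 2).
have eV0 : 0 < eta^-1 by rewrite invr_gt0.
have L0 : 0 < L by rewrite mulr_gt0// addr_gt0 ?powR_gt0.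
exists (8 * L), (eta / 16); split; rewrite ?mulr_gt0 ?divr_gt0//.
move=> N a u B Z mB PB mZ u0 ua.
set I1 := (\int[P]_(w in B) _)%E; set I2 := (\int[P]_w _)%E.
set S2 := \sum_(n < N) _ in ua.
have S20 : 0 <= S2 by apply: le_trans ua; exact: sqr_ge0.
pose s := Num.sqrt S2.
have us : u <= s by rewrite -[u](ger0_norm (ltW u0)) -sqrtr_sqr ler_wsqrtr.
have s0 : 0 < s by apply: lt_le_trans us.
pose v := (s^-1)%:C%C.
have b1 : \sum_(n < N) cabs (a n * v) ^+ 2 = 1 by
  exact: sum_sqr_cabs_normalized.
pose S := gauss_sum g N (fun n => a n * v).
have mS : measurable_fun setT S by exact: measurable_gauss_sum.
have I10 : (0 <= I1)%E by apply: integral_ge0 => w _; rewrite lee_fin powR_ge0.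
have I20 : (0 <= I2)%E by apply: integral_ge0 => w _; rewrite lee_fin powR_ge0.
pose f1 w := (u `^ (- p)) * (\1_B w * cabs (Z w) `^ p).
pose f2 w := (u `^ (- 2)) * cabs (gauss_sum g N a w - Z w) `^ 2.
have mind (A : set Omega) : measurable A -> measurable_fun setT (\1_A : Omega -> R).
  by move=> mA; exact: measurable_indic.
have mpow (f : Omega -> R[i]) q : measurable_fun setT f ->
    measurable_fun setT (fun w => cabs (f w) `^ q).
  by move=> mf; apply/measurable_EFinP; exact: measurable_cabs_powR.
have mSZ : measurable_fun setT (fun w => gauss_sum g N a w - Z w).
  by apply: measurable_complexB => //; exact: measurable_gauss_sum.
have mf1 : measurable_fun setT f1.
  by apply: measurable_funM => //; apply: measurable_funM; [exact: mind|exact: mpow].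
have mf2 : measurable_fun setT f2 by apply: measurable_funM => //; exact: mpow.
have f10 w : 0 <= f1 w by rewrite !mulr_ge0 ?powR_ge0.
have f20 w : 0 <= f2 w by rewrite !mulr_ge0 ?powR_ge0.
have If1 : (\int[P]_w (f1 w)%:E = (u `^ (- p))%:E * I1)%E.
  under eq_integral do rewrite EFinM.
  rewrite ge0_integralZl_EFin ?powR_ge0//; last 2 first.
  - by move=> w _; rewrite lee_fin mulr_ge0 ?powR_ge0.
  - by apply/measurable_EFinP; apply: measurable_funM; [exact: mind|exact: mpow].
  congr (_ * _)%E; rewrite /I1 [RHS]integral_mkcond; apply: eq_integral => w _.
  by rewrite patchE indicE; case: (w \in B); rewrite ?mul1r ?mul0r.
have If2 : (\int[P]_w (f2 w)%:E = (u `^ (- 2))%:E * I2)%E.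
  under eq_integral do rewrite EFinM.
  rewrite ge0_integralZl_EFin ?powR_ge0//; last first.
  - by apply/measurable_EFinP; exact: mpow.
  by move=> w _; rewrite lee_fin powR_ge0.
pose f3 w := eta^-1 * \1_(~` B) w.
have mf3 : measurable_fun setT f3.
  by apply: measurable_funM => //; apply: mind; exact: measurableC.
have f30 w : 0 <= f3 w by rewrite mulr_ge0// invr_ge0 ltW.
have If3 : (\int[P]_w (f3 w)%:E <= (1 / 16)%:E)%E.
  under eq_integral do rewrite EFinM.
  rewrite ge0_integralZl_EFin ?invr_ge0 ?(ltW eta0)//; last first.
    by apply/measurable_EFinP; apply: mind; exact: measurableC.
  rewrite integral_indic ?setIT//; last exact: measurableC.
  apply: (@le_trans _ _ (eta^-1%:E * (eta / 16)%:E)%E).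
    by rewrite lee_wpmul2l// lee_fin invr_ge0 ltW.
  by rewrite -EFinM lee_fin mulrA mulVf ?gt_eqF.
pose f4 w := eta * expR (complex.Re (S w * 2)).
have mf4' : measurable_fun setT (fun w => expR (complex.Re (S w * 2))).
  by apply: measurable_expR_Re; exact: measurable_complexM.
have mf4 : measurable_fun setT f4 by apply: measurable_funM.
have f40 w : 0 <= f4 w by rewrite mulr_ge0 ?expR_ge0 ?(ltW eta0).
have If4 : (\int[P]_w (f4 w)%:E = (1 / 16)%:E)%E.
  under eq_integral do rewrite EFinM.
  rewrite ge0_integralZl_EFin ?(ltW eta0)//; last exact/measurable_EFinP.
  rewrite gauss_sum_mgfZ// -EFinM; congr EFin.
  rewrite (_ : cabs 2 = 2); last first.
    by rewrite cabsE/= addr0 expr0n/= addr0 sqrtr_sqr ger0_norm.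
  rewrite (_ : 2 ^+ 2 / 2 = 2 :> R); last by field.
  rewrite /eta; field.
  by rewrite gt_eqF// expR_gt0.
have key : (\int[P]_w (expR (complex.Re (S w)))%:E <=
    \int[P]_w ((5 / 4)%:E + L%:E * ((f1 w)%:E + (f2 w)%:E)
               + (f3 w)%:E + (f4 w)%:E))%E.
  apply: ge0_le_integral => //.
  - by apply/measurable_EFinP; exact: measurable_expR_Re.
  - apply/measurable_EFinP; apply: measurable_funD => //.
    apply: measurable_funD => //; apply: measurable_funD => //.
    by apply: measurable_funM => //; exact: measurable_funD.
  - move=> w _; rewrite -!(EFinD, EFinM) lee_fin.
    have := @expR_le_split p eta (w \in B) (S w) (Z w * v) p0 eta0.
    rewrite -!indicE.
    have -> : 2 * complex.Re (S w) = complex.Re (S w * 2).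
      by case: (S w) => x y; rewrite /= addr0 mulr0 subr0 mulrC.
    move=> h; apply: (le_trans h).
    rewrite /f3 /f4 !indicE in_setC !lerD2r lerD2l /L -mulrA.
    rewrite ler_wpM2l ?invr_ge0 ?(ltW eta0)//.
    rewrite mulrDl; apply: lerD; rewrite ler_wpM2l ?powR_ge0//.
      apply: (@le_trans _ _ (f1 w)); last by rewrite lerDl.
      by rewrite /f1 mulrCA indicE ler_wpM2l// cabsZ_powR_le ?(ltW p0).
    apply: (@le_trans _ _ (f2 w)); last by rewrite lerDr.
    by rewrite /f2 /S -gauss_sumZ -mulrBl cabsZ_powR_le.
move: key.
have q0 w : 0 <= L * (f1 w + f2 w) by rewrite mulr_ge0 ?(ltW L0)// addr_ge0.
rewrite gauss_sum_mgf// b1 ge0_integralD//; last 4 first.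
- move=> w _; rewrite -!(EFinD, EFinM) lee_fin.
  by have := q0 w; have := f30 w; lra.
- apply/measurable_EFinP; apply: measurable_funD => //.
  apply: measurable_funD => //.
  by apply: measurable_funM => //; exact: measurable_funD.
- by move=> w _; rewrite lee_fin.
- exact/measurable_EFinP.
rewrite ge0_integralD//; last 4 first.
- move=> w _; rewrite -!(EFinD, EFinM) lee_fin.
  by have := q0 w; have := f30 w; lra.
- apply/measurable_EFinP; apply: measurable_funD => //.
  by apply: measurable_funM => //; exact: measurable_funD.
- by move=> w _; rewrite lee_fin.
- exact/measurable_EFinP.
rewrite ge0_integralD//; last 2 first.
- move=> w _; rewrite -!(EFinD, EFinM) lee_fin.
  exact: q0.
- apply/measurable_EFinP.
  by apply: measurable_funM => //; exact: measurable_funD.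
rewrite ge0_integralZl_EFin ?(ltW L0)//; last 2 first.
- by move=> w _; rewrite -EFinD lee_fin addr_ge0.
- by apply/measurable_EFinP; exact: measurable_funD.
rewrite ge0_integralD//; last 4 first.
- by move=> w _; rewrite lee_fin.
- exact/measurable_EFinP.
- by move=> w _; rewrite lee_fin.
- exact/measurable_EFinP.
rewrite integral_cst//= probability_setT mule1 If1 If2 If4.
move: If3; set I3 := (\int[P]_w (f3 w)%:E)%E => If3 key.
have {}key : ((3 / 2)%:E <= (5 / 4)%:E
  + L%:E * ((u `^ (- p))%:E * I1 + (u `^ (- 2))%:E * I2) + (1 / 16)%:E + (1 / 16)%:E)%E.
  apply: (@le_trans _ _ (expR (1 / 2))%:E).
    rewrite lee_fin; apply: le_trans (expR_ge1Dx _); lra.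
  apply: (le_trans key); do 2 apply: leeD => //.
move: key; set Y := (_ * I1 + _)%E => key.
have Y0 : (0 <= Y)%E by rewrite adde_ge0// mule_ge0// lee_fin powR_ge0.
clearbody Y; case: Y Y0 key => [y| |]// y0.
  rewrite -!(EFinD, EFinM) !lee_fin => key; lra.
by move=> _; rewrite gt0_muley ?lte_fin ?mulr_gt0// leey.
Qed.

End gaussian_lower_bound.

(** * Norms and vanishing integrals *)

Section vanishing_integrals.
Local Open Scope ereal_scope.
Context (R : realType).

Lemma cvge0P (u : nat -> \bar R) : (forall n, 0 <= u n) ->
  (u n @[n --> \oo] --> 0) <->
  (forall eps : R, (0 < eps)%R -> exists n0, forall n, (n0 <= n)%N -> u n < eps%:E).
Proof.
move=> u0; split=> [/fine_cvgP[[n1 _ ufin] ucvg] eps eps0|small].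
  move/cvgr0Pnorm_lt : ucvg => /(_ _ eps0)[n2 _ n2P].
  exists (maxn n1 n2) => n; rewrite geq_max => /andP[n1n n2n].
  have := n2P n n2n; rewrite /= ger0_norm ?fine_ge0// -lte_fin fineK//.
  exact: ufin.
apply/fine_cvgP; split.
  have [n0 n0P] := small 1%R ltr01; exists n0 => // n /= n0n.
  by rewrite ge0_fin_numE// (lt_trans (n0P n n0n))// ltry.
apply/cvgr0Pnorm_lt => eps eps0; have [n0 n0P] := small eps eps0.
exists n0 => // n /= n0n; have une := n0P n n0n.
rewrite ger0_norm ?fine_ge0// -lte_fin fineK// ge0_fin_numE//.
by rewrite (lt_trans une)// ltry.
Qed.

Lemma lt_poweRV (x : \bar R) (eps q : R) : (0 < q)%R -> (0 < eps)%R -> 0 <= x ->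
  (x `^ q^-1 < eps%:E) = (x < (eps `^ q)%R%:E).
Proof.
move=> q0 eps0; have epsE : eps = ((eps `^ q) `^ q^-1)%R.
  by rewrite -powRrM divff ?gt_eqF// powRr1// ltW.
case: x => [x x0| _|//]; last by rewrite poweRyr ?invr_eq0 ?gt_eqF.
rewrite poweR_EFin !lte_fin; rewrite lee_fin in x0.
rewrite [in LHS]epsE; apply/idP/idP => [|xe].
  apply: contraTT; rewrite -!leNgt => ?.
  by apply: ge0_ler_powR; rewrite ?nnegrE ?invr_ge0 ?powR_ge0 ?(ltW q0).
by apply: gt0_ltr_powR; rewrite ?nnegrE ?invr_gt0 ?powR_ge0.
Qed.

Context d (T : measurableType d) (mu : {measure set T -> \bar R}).

Lemma LnormCE p (f : T -> R[i]) : p != 0%R ->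
  LnormC mu p f = (\int[mu]_x (cabs (f x) `^ p)%R%:E) `^ p^-1.
Proof.
move=> p0; rewrite /LnormC unlock; congr (_ `^ _).
by apply: eq_integral => x _; rewrite poweR_EFin /= ger0_norm// cabs_ge0.
Qed.

Lemma LnormC_lty p (f : T -> R[i]) : (0 < p)%R ->
  (LnormC mu p f < +oo) <-> (\int[mu]_x (cabs (f x) `^ p)%R%:E < +oo).
Proof.
move=> p0; rewrite LnormCE ?gt_eqF//; split; last exact: poweR_lty.
by apply: lty_poweRy; rewrite invr_eq0 gt_eqF.
Qed.

Lemma integral_cabs_powR_ge0 D p (f : T -> R[i]) :
  0 <= \int[mu]_(x in D) (cabs (f x) `^ p)%R%:E.
Proof. by apply: integral_ge0 => x _; rewrite lee_fin powR_ge0. Qed.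

Lemma LnormC_cvg0 p (f : nat -> T -> R[i]) : (0 < p)%R ->
  (LnormC mu p (f N) @[N --> \oo] --> 0) <->
  (\int[mu]_x (cabs (f N x) `^ p)%R%:E @[N --> \oo] --> 0).
Proof.
move=> p0.
rewrite !cvge0P; last 2 first.
- by move=> N; exact: integral_cabs_powR_ge0.
- by move=> N; exact: Lnorm_ge0.
split=> small eps eps0.
  have e0 : (0 < eps `^ p^-1)%R by rewrite powR_gt0.
  have [n0 n0P] := small _ e0; exists n0 => n /n0P.
  rewrite LnormCE ?gt_eqF// lt_poweRV// ?integral_cabs_powR_ge0//.
  by rewrite -powRrM mulVf ?gt_eqF// powRr1// ltW.
have e0 : (0 < eps `^ p)%R by rewrite powR_gt0.
have [n0 n0P] := small _ e0; exists n0 => n /n0P.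
by rewrite LnormCE ?gt_eqF// lt_poweRV// ?integral_cabs_powR_ge0.
Qed.

(** By Fatou's lemma the inferior limit of the functions has integral zero, hence
    it vanishes almost everywhere. *)
Lemma ae_frequently_small (phi : nat -> T -> \bar R) :
  (forall n, measurable_fun setT (phi n)) -> (forall n x, 0 <= phi n x) ->
  \int[mu]_x phi n x @[n --> \oo] --> 0 ->
  {ae mu, forall x, forall eps : R, (0 < eps)%R ->
    forall n0, exists2 n, (n0 <= n)%N & phi n x < eps%:E}.
Proof.
move=> mphi phi0 phicvg.
have liminf0 x : 0 <= limn_einf (phi^~ x).
  rewrite limn_einf_lim; apply: lime_ge.
    exact: is_cvg_einfs.
  by apply: nearW => n; apply: le_ereal_inf_tmp => _ [k _ <-]; exact: phi0.
have mliminf : measurable_fun setT (fun x => limn_einf (phi^~ x)).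
  rewrite (_ : (fun x => _) = fun x => - limn_esup (fun n => - phi n x)).
    apply: measurableT_comp => //; apply: measurable_fun_limn_esup => n.
    exact: measurableT_comp.
  apply/funext => x; rewrite -limn_einfN; congr limn_einf.
  by apply/funext => n /=; rewrite oppeK.
have int0 : \int[mu]_x `|limn_einf (phi^~ x)| = 0.
  apply/eqP; rewrite eq_le integral_ge0// andbT.
  rewrite (eq_integral (fun x => limn_einf (phi^~ x))); last first.
    by move=> x _; rewrite gee0_abs.
  apply: (le_trans (fatou mu measurableT mphi _)); first by move=> n x _.
  by rewrite (cvg_limn_einf_sup phicvg).1.
have := (ae_eq_integral_abs mu measurableT mliminf).1 int0.
apply: filterS => x /(_ I)/= xE eps eps0 n0.
have : einfs (phi^~ x) n0 < eps%:E.
  apply: (@le_lt_trans _ _ 0); last by rewrite lte_fin.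
  rewrite -xE limn_einf_lim.
  have /cvg_lim -> // := @cvg_einfs_sup R (phi^~ x).
  by apply: ereal_sup_ubound; exists n0.
by move=> /ereal_inf_lt[_ [n /= n0n <-] ?]; exists n.
Qed.

End vanishing_integrals.

(** * Terms of a series with almost surely finite norm *)

Section bounded_event.
Local Open Scope ereal_scope.
Context (R : realType) d (T : measurableType d) (P : probability T R).

(** The events where [Phi] exceeds the integer [n] decrease to an event of
    probability zero. *)
Lemma ae_finite_bounded (Phi : T -> \bar R) (eps : R) :
  measurable_fun setT Phi -> {ae P, forall w, Phi w < +oo} -> (0 < eps)%R ->
  exists2 M : R, (0 <= M)%R & P [set w | M%:E < Phi w] < eps%:E.
Proof.
move=> mPhi Phifin eps0.
pose D n := [set w | n%:R%:E < Phi w].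
have mD n : measurable (D n).
  by rewrite -[D n]setTI; exact: emeasurable_fun_o_infty.
have capD0 : P (\bigcap_n D n) = 0.
  apply: measure_negligible; first exact: bigcapT_measurable.
  apply: negligibleS Phifin => w /= Dw /= Phiw.
  have [n Phin] : exists n, Phi w < n%:R%:E.
    case: (Phi w) Phiw => [r _| //|_]; last by exists 0%N; rewrite ltNyr.
    by exists (Num.Def.trunc r).+1; rewrite lte_fin truncnS_gt.
  by have := Dw n I; rewrite /D/= ltNge (ltW Phin).
have niD : nonincreasing_seq D.
  move=> m n mn; rewrite subsetEset => w; rewrite /D/=.
  by apply: le_lt_trans; rewrite lee_fin ler_nat.
have PD : P (D n) @[n --> \oo] --> 0.
  rewrite -capD0; apply: nonincreasing_cvg_mu => //.
    by rewrite (le_lt_trans (probability_le1 _ _))// ltry.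
  exact: bigcapT_measurable.
have [n0 n0P] := (cvge0P (fun n => measure_ge0 P (D n))).1 PD eps eps0.
by exists n0%:R => //; exact: n0P.
Qed.

End bounded_event.

Section series_on_product.
Context (R : realType) dO (Omega : measurableType dO) (P : probability Omega R).
Context dY (Y : measurableType dY) (mu : {finite_measure set Y -> \bar R}).
Variables (g : nat -> {RV P >-> R[i]}) (e : nat -> {mfun Y >-> R[i]}).
Implicit Types c : nat -> R[i].

Lemma partial_seriesE c N w y :
  partial_series g e c N (w, y) = gauss_sum g N (fun n => c n * e n y) w.
Proof. by apply: eq_bigr => n _; rewrite mulrA. Qed.

Lemma measurable_partial_series c N :
  measurable_fun setT (partial_series g e c N).
Proof.
apply: (@measurable_complex_sum R _ _ N (fun n x => g n x.1 * c n * e n x.2)) => n.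
apply: measurable_complexM.
  apply: measurable_complexM => //.
  by apply: (@measurableT_comp _ _ _ _ _ _ (g n) _ fst).
by apply: (@measurableT_comp _ _ _ _ _ _ (e n) _ snd).
Qed.

Lemma measurable_term n :
  measurable_fun setT (fun x : Omega * Y => g n x.1 * e n x.2).
Proof.
apply: measurable_complexM.
  by apply: (@measurableT_comp _ _ _ _ _ _ (g n) _ fst).
by apply: (@measurableT_comp _ _ _ _ _ _ (e n) _ snd).
Qed.

Lemma fubini_cabs_powR (f : Omega * Y -> R[i]) q : measurable_fun setT f ->
  (\int[(P \x mu)%E]_x (cabs (f x) `^ q)%:E =
   \int[mu]_y \int[P]_w (cabs (f (w, y)) `^ q)%:E)%E.
Proof.
move=> mf; have mfq := measurable_cabs_powR q mf.
rewrite fubini_tonelli1//; last by move=> x; rewrite lee_fin powR_ge0.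
rewrite -(@fubini_tonelli _ _ _ _ _ P mu (fun x => (cabs (f x) `^ q)%:E))//.
by move=> x; rewrite lee_fin powR_ge0.
Qed.

Lemma measurable_integral_cabs_powR (f : Omega * Y -> R[i]) q :
  measurable_fun setT f ->
  measurable_fun setT (fun y => \int[P]_w (cabs (f (w, y)) `^ q)%:E)%E.
Proof.
move=> mf; apply: (@measurable_fun_fubini_tonelli_G _ _ _ _ _ P
  (fun x => (cabs (f x) `^ q)%:E)) => //.
- exact: measurable_cabs_powR.
- by move=> x; rewrite lee_fin powR_ge0.
Qed.


(** Almost every [y] is such that the partial sums at [y] come arbitrarily close
    to [F] in mean square infinitely often; for these [y] the anticoncentration
    of Gaussian sums bounds each term by the size of [F] on the event where the
    norm of [F] is bounded. *)
Lemma series_term_bound p c (F : {mfun (Omega * Y)%type >-> R[i]}) :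
  mutually_independent g -> (forall n, complex_gaussian 1 (g n)) -> 0 < p ->
  is_random_series mu g e c F ->
  {ae P, forall w, (LnormC mu p (fun y => F (w, y)) < +oo)%E} ->
  exists M : R, forall n, ((cabs (c n) `^ p)%:E *
    \int[mu]_y (cabs (e n y) `^ p)%:E <= M%:E)%E.
Proof.
move=> indepg gaussg p0 [_ cvgF] Ffin.
have mF : measurable_fun setT F by exact: measurable_funP.
have [K [eps [K0 eps0 lower]]] := gauss_sum_anticoncentration indepg gaussg p0.
pose Phi w := (\int[mu]_y (cabs (F (w, y)) `^ p)%:E)%E.
have mPhi : measurable_fun setT Phi.
  apply: (@measurable_fun_fubini_tonelli_F _ _ _ _ _ mu
    (fun x => (cabs (F x) `^ p)%:E)) => //; first exact: measurable_cabs_powR.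
  by move=> x; rewrite lee_fin powR_ge0.
have Phifin : {ae P, forall w, (Phi w < +oo)%E}.
  by apply: filterS Ffin => w; rewrite LnormC_lty.
have [M M0 PM] := ae_finite_bounded mPhi Phifin eps0.
pose B := [set w | (Phi w <= M%:E)%E].
have mB : measurable B.
  by rewrite -[B]setTI; exact: emeasurable_fun_infty_c.
have PB : (P (~` B) <= eps%:E)%E.
  rewrite (_ : ~` B = [set w | (M%:E < Phi w)%E]); first exact: ltW.
  by apply/seteqP; split => w /=; [move/negP; rewrite -ltNge|rewrite ltNge => /negP].
exists (K * M) => n.
pose phi N y := (\int[P]_w (cabs (partial_series g e c N (w, y) - F (w, y)) `^ 2)%:E)%E.
have mSF N : measurable_fun setT (fun x => partial_series g e c N x - F x).
  by apply: measurable_complexB => //; exact: measurable_partial_series.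
have phicvg : (\int[mu]_y phi N y @[N --> \oo] --> 0)%E.
  move/LnormC_cvg0 : cvgF; rewrite ltr0n => /(_ isT).
  by under eq_fun do rewrite fubini_cabs_powR//.
pose G y := (\int[P]_(w in B) (cabs (F (w, y)) `^ p)%:E)%E.
have GE y : G y = (\int[P]_w ((\1_B w)%:E * (cabs (F (w, y)) `^ p)%:E))%E.
  rewrite /G integral_mkcond; apply: eq_integral => w _.
  by rewrite patchE indicE; case: (w \in B); rewrite ?mul1e ?mul0e.
pose h (x : Omega * Y) := ((\1_B x.1)%:E * (cabs (F x) `^ p)%:E)%E.
have mh : measurable_fun setT h.
  apply: emeasurable_funM; last exact: measurable_cabs_powR.
  apply/measurable_EFinP.
  by apply: (@measurableT_comp _ _ _ _ _ _ (\1_B : Omega -> R) _ fst).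
have h0 x : (0 <= h x)%E by rewrite mule_ge0// lee_fin powR_ge0.
have mG : measurable_fun setT G.
  rewrite (_ : G = fubini_G P h); last by apply/funext => y; exact: GE.
  exact: measurable_fun_fubini_tonelli_G.
have intG : (\int[mu]_y G y <= M%:E)%E.
  under eq_integral do rewrite GE.
  rewrite -(@fubini_tonelli _ _ _ _ _ P mu h)//.
  apply: (@le_trans _ _ (\int[P]_w (cst M%:E w))%E); last first.
    by rewrite integral_cst//= probability_setT mule1.
  apply: ge0_le_integral => //.
  - by move=> w _; apply: integral_ge0 => y _; exact: h0.
  - exact: (@measurable_fun_fubini_tonelli_F _ _ _ _ _ mu h).
  - move=> w _; rewrite /h/=.
    rewrite ge0_integralZl_EFin//; last 2 first.
    + by move=> y _; rewrite lee_fin powR_ge0.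
    + apply: measurable_cabs_powR; exact: measurable_fun_pair2.
    rewrite -/(Phi w) indicE; have [wB|wB] := boolP (w \in B).
      by rewrite mul1e; move: wB; rewrite inE.
    by rewrite mul0e lee_fin.
pose u y := cabs (c n * e n y).
have aeuG : {ae mu, forall y, setT y -> ((u y `^ p)%:E <= K%:E * G y)%E}.
  apply: filterS (ae_frequently_small (phi := phi) _ _ phicvg).
  - move=> y small _.
    have G0 : (0 <= G y)%E by exact: integral_cabs_powR_ge0.
    have [u0|u0] := leP (u y) 0.
      have -> : u y = 0 by apply/eqP; rewrite eq_le u0 cabs_ge0.
      by rewrite powR0 ?gt_eqF// mule_ge0// lee_fin ltW.
    case GyE : (G y) G0 => [r| |] // r0; last by rewrite gt0_muley ?lte_fin// leey.
    rewrite -EFinM lee_fin leNgt; apply/negP => Kru.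
    (* If [K * r] is less than [u y `^ p], then the conclusion of [lower] forces
       [phi N y] to be at least [gap]. *)
    pose gap := u y `^ 2 * (K^-1 - u y `^ (- p) * r).
    have gap0 : 0 < gap.
      rewrite mulr_gt0 ?powR_gt0// subr_gt0 powRN mulrC.
      by rewrite ltr_pdivrMr ?powR_gt0// ltr_pdivlMl.
    have [N nN phiN] := small gap gap0 n.+1.
    have phi0 : (0 <= phi N y)%E by exact: integral_cabs_powR_ge0.
    have mFy : measurable_fun setT (fun w => F (w, y)) by exact: measurable_fun_pair1.
    have uS : u y ^+ 2 <= \sum_(k < N) cabs (c k * e k y) ^+ 2.
      rewrite (bigD1 (Ordinal nN))//= lerDl.
      by apply: sumr_ge0 => i _; exact: sqr_ge0.
    have := lower N (fun k => c k * e k y) (u y) B _ mB PB mFy u0 uS.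
    have -> : (\int[P]_w (cabs (gauss_sum g N (fun n => c n * e n y) w - F (w, y)) `^ 2)%:E)%E
      = phi N y by apply: eq_integral => w _; rewrite partial_seriesE.
    rewrite -/(G y) GyE.
    case: (phi N y) phi0 phiN => [f|//|//]; rewrite lee_fin lte_fin => f0 fgap.
    rewrite -!(EFinM, EFinD) lee_fin.
    apply/negP; rewrite -ltNge -ltr_pdivlMl// mulr1 -ltrBrDl.
    by move: fgap; rewrite /gap !powRN => fgap; rewrite ltr_pdivrMl ?powR_gt0.
  - by move=> N; exact: (measurable_integral_cabs_powR 2 (mSF N)).
  - by move=> N y; exact: integral_cabs_powR_ge0.
have mu_ : measurable_fun setT (fun y => (u y `^ p)%:E).
  by apply: measurable_cabs_powR; exact: measurable_complexM.
apply: (@le_trans _ _ (\int[mu]_y (u y `^ p)%:E)%E).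
  rewrite -ge0_integralZl_EFin ?powR_ge0//; last 2 first.
  - by move=> y _; rewrite lee_fin powR_ge0.
  - exact: measurable_cabs_powR.
  rewrite le_eqVlt; apply/orP; left; apply/eqP; apply: eq_integral => y _.
  by rewrite -EFinM -powRM ?cabs_ge0// -cabsM.
apply: (@le_trans _ _ (\int[mu]_y (K%:E * G y))%E).
  apply: ae_ge0_le_integral => //.
  - by move=> y _; rewrite lee_fin powR_ge0.
  - by move=> y _; rewrite mule_ge0 ?lee_fin ?(ltW K0)//; exact: integral_cabs_powR_ge0.
  - exact: measurable_funeM.
rewrite ge0_integralZl_EFin ?(ltW K0)//; last first.
  by move=> y _; exact: integral_cabs_powR_ge0.
by rewrite EFinM lee_wpmul2l// lee_fin ltW.
Qed.

End series_on_product.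

(** * Power mean inequality *)

Section power_mean.
Context (R : realType).

(** This is Young's inequality for the product of [x] and [m `^ (q - 1)]; the
    exponent conjugate to [q] exists only if [q] is not equal to one. *)
Lemma powR_tangent (q m x : R) : 1 <= q -> 0 <= m -> 0 <= x ->
  m `^ q + q * (m `^ (q - 1) * (x - m)) <= x `^ q.
Proof.
move=> q1 m0 x0; have q0 : 0 < q by lra.
have mq : m `^ (q - 1) * m = m `^ q by rewrite mulrC mulr_powRB1.
have [qE|qN1] := eqVneq q 1.
  by rewrite qE subrr powRr0 !mul1r !powRr1// addrC subrK.
have q10 : 0 < q - 1 by rewrite subr_gt0 lt_neqAle eq_sym qN1.
have qq : q^-1 + (q / (q - 1))^-1 = 1.
  by rewrite invf_div -[X in X + _]mul1r -mulrDl subrKC mulfV ?gt_eqF.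
have := conjugate_powR x0 (powR_ge0 m (q - 1)) q0 (divr_gt0 q0 q10) qq.
rewrite -powRrM [(q - 1) * _](_ : _ = q); last first.
  by rewrite mulrC divfK// gt_eqF.
move=> /(ler_wpM2l (ltW q0)).
rewrite mulrDr [q * (_ / q)]mulrCA mulfV ?gt_eqF// mulr1.
rewrite [X in _ <= _ + X](_ : _ = (q - 1) * m `^ q); last first.
  by rewrite invf_div mulrCA [q * (_ / q)]mulrCA mulfV ?gt_eqF// mulr1 mulrC.
by move=> h; rewrite mulrBr mq [_ * x]mulrC; lra.
Qed.

(** Summing the tangent inequalities at the weighted mean [m] of the [x n] makes
    the linear terms cancel. *)
Lemma power_mean (q : R) N (w x : nat -> R) : 1 <= q ->
  (forall n, 0 <= w n) -> (forall n, 0 <= x n) ->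
  (\sum_(n < N) w n * x n) `^ q <=
  (\sum_(n < N) w n) `^ (q - 1) * \sum_(n < N) w n * x n `^ q.
Proof.
move=> q1 w0 x0; have q0 : 0 < q by lra.
set W := \sum_(n < N) w n; set S := \sum_(n < N) w n * x n.
have W0 : 0 <= W by apply: sumr_ge0.
have S0 : 0 <= S by apply: sumr_ge0 => n _; exact: mulr_ge0.
have sum0 : 0 <= \sum_(n < N) w n * x n `^ q.
  by apply: sumr_ge0 => n _; rewrite mulr_ge0 ?powR_ge0.
have [WE|WN0] := eqVneq W 0.
  suff -> : S = 0 by rewrite powR0 ?gt_eqF// mulr_ge0 ?powR_ge0.
  rewrite /S big1// => n _; move/eqP: WE; rewrite psumr_eq0//.
  by move=> /allP/(_ n); rewrite mem_index_enum => /(_ isT)/= /eqP ->; rewrite mul0r.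
have Wgt0 : 0 < W by rewrite lt0r WN0.
pose m := S / W; have m0 : 0 <= m by rewrite divr_ge0.
have -> : S = W * m by rewrite /m mulrCA mulfV// mulr1.
rewrite powRM// -(mulr_powRB1 W0 q0) mulrAC mulrC ler_wpM2l ?powR_ge0//.
apply: (@le_trans _ _ (\sum_(n < N) (w n * m `^ q +
    q * m `^ (q - 1) * (w n * x n - m * w n)))).
  rewrite big_split/= -mulr_suml -mulr_sumr sumrB -mulr_sumr.
  rewrite -/W -/S [S](_ : _ = m * W); last by rewrite /m divfK.
  by rewrite subrr mulr0 addr0 mulrC.
apply: ler_sum => n _; rewrite [m * w n]mulrC -mulrBr mulrCA -mulrDr.
by rewrite ler_wpM2l// -mulrA powR_tangent.
Qed.

End power_mean.

(** * Series with summable coefficients *)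

Section complex_series.
Context (R : realType).
Implicit Types (c z : nat -> R[i]).

Lemma Re_sum N (f : 'I_N -> R[i]) :
  complex.Re (\sum_(n < N) f n) = \sum_(n < N) complex.Re (f n).
Proof. by elim/big_ind2 : _ => // x [a b] y [a' b'] /= <- <-. Qed.

Lemma Im_sum N (f : 'I_N -> R[i]) :
  complex.Im (\sum_(n < N) f n) = \sum_(n < N) complex.Im (f n).
Proof. by elim/big_ind2 : _ => // x [a b] y [a' b'] /= <- <-. Qed.

Lemma cvg_series_bounded (u : nat -> R) (b : R) :
  (forall N, \sum_(n < N) `|u n| <= b) -> cvgn (fun N => \sum_(n < N) u n).
Proof.
move=> ub; rewrite (_ : (fun N => _) = series u); last first.
  by apply/funext => N; rewrite /series/= big_mkord.
apply: normed_cvg; apply: nondecreasing_is_cvgn.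
  by apply: nondecreasing_series => n _ _; exact: normr_ge0.
exists b => _ [N _ <-]; apply: le_trans (ub N).
by rewrite -(big_mkord xpredT (fun n => `|u n|)).
Qed.

Lemma lim_sqr_dist_le (u : nat -> R) (l v b : R) N : u n @[n --> \oo] --> l ->
  (forall M, (N <= M)%N -> (v - u M) ^+ 2 <= b) -> (v - l) ^+ 2 <= b.
Proof.
move=> ul ub.
have cvgv : (v - u n) ^+ 2 @[n --> \oo] --> (v - l) ^+ 2.
  rewrite expr2; under eq_fun do rewrite expr2.
  by apply: cvgM; apply: cvgB => //; exact: cvg_cst.
rewrite -(cvg_lim _ cvgv)//; apply: limr_le; first by apply/cvg_ex; eexists; exact: cvgv.
by exists N.
Qed.

(** Cauchy's inequality with the weights [cabs (c n)]. *)
Lemma weighted_sum_dist_le c z (h : R) N M : (N <= M)%N ->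
  \sum_(n < M) cabs (c n) * cabs (z n) `^ 2 <= h ->
  cabs (\sum_(n < N) z n * c n - \sum_(n < M) z n * c n) ^+ 2 <=
  (\sum_(n < M) cabs (c n) - \sum_(n < N) cabs (c n)) * h.
Proof.
move=> NM sumh.
pose w n := if (n < N)%N then 0 else cabs (c n).
have split_sum (V : zmodType) (f : nat -> V) :
    \sum_(n < M) f n - \sum_(n < N) f n = \sum_(n < M) if (n < N)%N then 0 else f n.
  rewrite (big_ord_widen _ f NM) [X in X - _](bigID (fun n : 'I_M => (n < N)%N))/=.
  rewrite addrAC subrr add0r [RHS](bigID (fun n : 'I_M => (n < N)%N))/=.
  rewrite [X in _ = X + _]big1 ?add0r; last by move=> n ->.
  by apply: eq_bigr => n /negPf ->.
have w0 n : 0 <= w n by rewrite /w; case: ifP => // _; exact: cabs_ge0.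
have -> : \sum_(n < M) cabs (c n) - \sum_(n < N) cabs (c n) = \sum_(n < M) w n.
  exact: (split_sum _ (fun n => cabs (c n))).
rewrite -normcN opprB (split_sum _ (fun n => z n * c n)) -powR_mulrn ?cabs_ge0//.
apply: (@le_trans _ _ ((\sum_(n < M) w n * cabs (z n)) `^ 2)).
  apply: ge0_ler_powR; rewrite ?nnegrE ?cabs_ge0//.
    by apply: sumr_ge0 => n _; rewrite mulr_ge0 ?cabs_ge0.
  apply: (le_trans (cabs_sum _)); apply: ler_sum => n _.
  by rewrite /w; case: ifP => _; rewrite ?cabs0 ?mul0r// cabsM mulrC.
apply: (le_trans (power_mean (x := fun n => cabs (z n)) _ _ w0 _)).
- by rewrite ler1n.
- by move=> n; exact: cabs_ge0.
rewrite (_ : 2 - 1 = 1); last by lra.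
rewrite powRr1; last exact: sumr_ge0.
rewrite ler_wpM2l//; first exact: sumr_ge0.
apply: le_trans sumh; apply: ler_sum => n _; rewrite ler_wpM2r ?powR_ge0//.
by rewrite /w; case: ifP => // _; exact: cabs_ge0.
Qed.

Lemma weighted_term_le c z (C h : R) :
  (forall N, \sum_(n < N) cabs (c n) <= C) ->
  (forall N, \sum_(n < N) cabs (c n) * cabs (z n) `^ 2 <= h) ->
  forall N, \sum_(n < N) cabs (z n * c n) <= C + h.
Proof.
move=> cC ch N; apply: (le_trans _ (lerD (cC N) (ch N))).
rewrite -big_split/=; apply: ler_sum => n _.
rewrite cabsM mulrC -[X in _ <= X + _]mulr1 -mulrDr ler_wpM2l ?cabs_ge0//.
rewrite powR_mulrn ?cabs_ge0//; have := sqr_ge0 (cabs (z n) - 1).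
by have := cabs_ge0 (z n); nra.
Qed.

Lemma cvg_Re_series c z (C h : R) :
  (forall N, \sum_(n < N) cabs (c n) <= C) ->
  (forall N, \sum_(n < N) cabs (c n) * cabs (z n) `^ 2 <= h) ->
  cvgn (fun N => complex.Re (\sum_(n < N) z n * c n)).
Proof.
move=> cC ch; under eq_fun do rewrite Re_sum.
apply: (@cvg_series_bounded (fun n => complex.Re (z n * c n)) (C + h)) => N.
apply: le_trans (weighted_term_le cC ch N); apply: ler_sum => n _.
by rewrite cabsE -sqrtr_sqr ler_wsqrtr// lerDl sqr_ge0.
Qed.

Lemma cvg_Im_series c z (C h : R) :
  (forall N, \sum_(n < N) cabs (c n) <= C) ->
  (forall N, \sum_(n < N) cabs (c n) * cabs (z n) `^ 2 <= h) ->
  cvgn (fun N => complex.Im (\sum_(n < N) z n * c n)).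
Proof.
move=> cC ch; under eq_fun do rewrite Im_sum.
apply: (@cvg_series_bounded (fun n => complex.Im (z n * c n)) (C + h)) => N.
apply: le_trans (weighted_term_le cC ch N); apply: ler_sum => n _.
by rewrite cabsE -sqrtr_sqr ler_wsqrtr// lerDr sqr_ge0.
Qed.

End complex_series.

Section existence.
Context (R : realType) dO (Omega : measurableType dO) (P : probability Omega R).
Context dY (Y : measurableType dY) (mu : {finite_measure set Y -> \bar R}).
Variables (g : nat -> {RV P >-> R[i]}) (e : nat -> {mfun Y >-> R[i]}).

(** For absolutely summable coefficients the partial sums converge almost
    everywhere: the function [H] below is integrable, hence almost everywhere
    finite, and it controls both the absolute convergence of the series and, by
    Cauchy's inequality, the distance from a partial sum to the limit. *)
Lemma random_series_exists (c : nat -> R[i]) (C K : R) :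
  \sum_(n < N) cabs (c n) @[N --> \oo] --> C ->
  (forall n, \int[(P \x mu)%E]_x (cabs (g n x.1 * e n x.2) `^ 2)%:E <= K%:E)%E ->
  exists F : {mfun (Omega * Y)%type >-> R[i]}, is_random_series mu g e c F.
Proof.
move=> cC zK; pose m := (P \x mu)%E.
pose z n (x : Omega * Y) := g n x.1 * e n x.2.
have mz n : measurable_fun setT (z n) by exact: measurable_term.
have SE N x : partial_series g e c N x = \sum_(n < N) z n x * c n.
  by apply: eq_bigr => n _; rewrite mulrAC.
have cC_le N : \sum_(n < N) cabs (c n) <= C.
  rewrite -(cvg_lim _ cC)//; apply: nondecreasing_cvgn_le; last exact: (cvgP _ cC).
  under eq_fun do rewrite -(big_mkord xpredT (fun n => cabs (c n))).
  by apply: nondecreasing_series => n _ _; exact: cabs_ge0.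
have K0 : 0 <= K.
  by rewrite -lee_fin; apply: le_trans (zK 0%N); exact: integral_cabs_powR_ge0.
pose H x := (\sum_(0 <= n <oo) (cabs (c n) * cabs (z n x) `^ 2)%:E)%E.
have term0 n x : (0 <= (cabs (c n) * cabs (z n x) `^ 2)%:E)%E.
  by rewrite lee_fin mulr_ge0 ?powR_ge0 ?cabs_ge0.
have mterm n : measurable_fun setT (fun x => (cabs (c n) * cabs (z n x) `^ 2)%:E).
  apply/measurable_EFinP; apply: measurable_funM => //.
  by apply/measurable_EFinP; exact: measurable_cabs_powR.
have mH : measurable_fun setT H by apply: ge0_emeasurable_sum.
have H0 x : (0 <= H x)%E by apply: nneseries_ge0.
have HN x N : ((\sum_(n < N) cabs (c n) * cabs (z n x) `^ 2)%:E <= H x)%E.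
  rewrite -sumEFin -(big_mkord xpredT (fun n => (cabs (c n) * cabs (z n x) `^ 2)%:E)).
  exact: nneseries_lim_ge.
have intH : (\int[m]_x H x <= (C * K)%:E)%E.
  rewrite integral_nneseries//; apply: lime_le.
    apply: is_cvg_nneseries => n _ _; apply: integral_ge0 => x _; exact: term0.
  apply: nearW => N; rewrite big_mkord.
  apply: (@le_trans _ _ (\sum_(n < N) (cabs (c n) * K)%:E)%E).
    apply: lee_sum => n _; under eq_integral do rewrite EFinM.
    rewrite ge0_integralZl_EFin ?cabs_ge0//; last 2 first.
      by move=> x _; rewrite lee_fin powR_ge0.
      exact: measurable_cabs_powR.
    by rewrite EFinM; apply: lee_wpmul2l; [rewrite lee_fin cabs_ge0|exact: zK].
  by rewrite sumEFin -mulr_suml lee_fin ler_wpM2r.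
pose D := [set x | (H x < +oo)%E].
have mD : measurable D by rewrite -[D]setTI; exact: emeasurable_fun_infty_o.
have aeD : {ae m, forall x, D x}.
  have /integrable_ae : m.-integrable setT H.
    apply/integrableP; split => //; under eq_integral do rewrite gee0_abs//.
    by rewrite (le_lt_trans intH)// ltry.
  move=> /(_ measurableT); apply: filterS => x /(_ I) Hx.
  by rewrite /D/= -ge0_fin_numE.
have finHN x N : D x -> \sum_(n < N) cabs (c n) * cabs (z n x) `^ 2 <= fine (H x).
  by move=> Dx; rewrite -lee_fin fineK ?ge0_fin_numE.
pose re N x : R := \1_D x * complex.Re (partial_series g e c N x).
pose im N x : R := \1_D x * complex.Im (partial_series g e c N x).
have cvg_re x : cvgn (re ^~ x).
  rewrite /re indicE; have [xD|xD] := boolP (x \in D); last first.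
    by under eq_fun do rewrite mul0r; exact: is_cvg_cst.
  under eq_fun do rewrite mul1r SE.
  apply: (@cvg_Re_series _ c (z ^~ x) C (fine (H x))) => // N.
  by apply: finHN; move: xD; rewrite inE.
have cvg_im x : cvgn (im ^~ x).
  rewrite /im indicE; have [xD|xD] := boolP (x \in D); last first.
    by under eq_fun do rewrite mul0r; exact: is_cvg_cst.
  under eq_fun do rewrite mul1r SE.
  apply: (@cvg_Im_series _ c (z ^~ x) C (fine (H x))) => // N.
  by apply: finHN; move: xD; rewrite inE.
pose f (x : Omega * Y) : R[i] := (limn (re ^~ x) +i* limn (im ^~ x))%C.
have mind : measurable_fun setT (\1_D : Omega * Y -> R) by exact: measurable_indic.
have mf : measurable_fun setT f.
  have mS N : measurable_fun setT (partial_series g e c N).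
    exact: measurable_partial_series.
  apply/measurable_complexP; split; rewrite /f/=.
    apply: (measurable_fun_cvg (h := re)) => [N|x _]; last exact: cvg_re.
    apply: measurable_funM => //.
    by have /measurable_complexP[] := mS N.
  apply: (measurable_fun_cvg (h := im)) => [N|x _]; last exact: cvg_im.
  apply: measurable_funM => //.
  by have /measurable_complexP[] := mS N.
pose tau N := C - \sum_(n < N) cabs (c n).
have tau0 N : 0 <= tau N by rewrite subr_ge0.
have dist_le N : (\int[m]_x (cabs (partial_series g e c N x - f x) `^ 2)%:E <=
    (2 * tau N * (C * K))%:E)%E.
  apply: (@le_trans _ _ (\int[m]_x ((2 * tau N)%:E * H x))%E); last first.
    rewrite ge0_integralZl_EFin ?mulr_ge0//.
    by rewrite [leRHS]EFinM lee_wpmul2l// lee_fin mulr_ge0.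
  apply: ae_ge0_le_integral => //.
  - by move=> x _; rewrite lee_fin powR_ge0.
  - apply: measurable_cabs_powR; apply: measurable_complexB => //.
    exact: measurable_partial_series.
  - by move=> x _; rewrite mule_ge0// lee_fin mulr_ge0.
  - exact: measurable_funeM.
  apply: filterS aeD => x Dx _.
  have HxE : H x = (fine (H x))%:E by rewrite fineK ?ge0_fin_numE.
  rewrite HxE -EFinM lee_fin powR_mulrn ?cabs_ge0// sqr_cabs.
  have bound M : (N <= M)%N -> cabs (partial_series g e c N x -
      partial_series g e c M x) ^+ 2 <= tau N * fine (H x).
    move=> NM; rewrite !SE.
    apply: (le_trans (weighted_sum_dist_le (z := z ^~ x) NM (finHN x M Dx))).
    rewrite ler_wpM2r ?fine_ge0// lerD2r; exact: cC_le.
  have Dx1 : \1_D x = 1 :> R by rewrite indicE mem_set.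
  have -> : complex.Re (partial_series g e c N x - f x) =
      complex.Re (partial_series g e c N x) - limn (re ^~ x).
    by case: (partial_series _ _ _ _ _).
  have -> : complex.Im (partial_series g e c N x - f x) =
      complex.Im (partial_series g e c N x) - limn (im ^~ x).
    by case: (partial_series _ _ _ _ _).
  rewrite -mulrA mulr_natl mulr2n; apply: lerD.
    apply: (@lim_sqr_dist_le R (re ^~ x) (limn (re ^~ x))
      (complex.Re (partial_series g e c N x)) (tau N * fine (H x)) N (cvg_re x)) => M NM.
    apply: le_trans (bound M NM); rewrite sqr_cabs /re Dx1 mul1r.
    case: (partial_series _ _ _ N _) (partial_series _ _ _ M _) => ? ? [? ?] /=.
    by rewrite lerDl sqr_ge0.
  apply: (@lim_sqr_dist_le R (im ^~ x) (limn (im ^~ x))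
      (complex.Im (partial_series g e c N x)) (tau N * fine (H x)) N (cvg_im x)) => M NM.
  apply: le_trans (bound M NM); rewrite sqr_cabs /im Dx1 mul1r.
  case: (partial_series _ _ _ N _) (partial_series _ _ _ M _) => ? ? [? ?] /=.
  by rewrite lerDr sqr_ge0.
(* The bound on the distance for [N = 0], where the partial sum is zero, gives the
   square integrability of the limit. *)
pose fmeas := isMeasurableFun.Build _ _ _ _ _ mf.
pose F : {mfun (Omega * Y)%type >-> R[i]} := HB.pack f fmeas.
exists F; split.
  apply/LnormC_lty => //.
  apply: (@le_lt_trans _ _ (\int[m]_x (cabs (partial_series g e c 0 x - f x) `^ 2)%:E)%E).
    rewrite le_eqVlt; apply/orP; left; apply/eqP; apply: eq_integral => x _.
    by rewrite /partial_series big_ord0 sub0r normcN.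
  by apply: le_lt_trans (dist_le 0%N) _; rewrite ltry.
apply/LnormC_cvg0 => //.
apply: (@squeeze_cvge _ _ _ _ (cst 0%E) _ (fun N => (2 * tau N * (C * K))%:E)).
- apply: nearW => N; rewrite integral_cabs_powR_ge0/=; exact: dist_le.
- exact: cvg_cst.
- rewrite -[X in _ --> X]/(0%R%:E); apply: cvg_EFin; first exact: nearW.
  rewrite -[X in _ --> X](mul0r (C * K)); apply: cvgM; last exact: cvg_cst.
  rewrite -[X in _ --> X](mulr0 2); apply: cvgM; first exact: cvg_cst.
  by rewrite -[X in _ --> X](subrr C); apply: cvgB => //; exact: cvg_cst.
Qed.

End existence.

(** * Necessity of bounded norms *)

Section norms_of_basis.
Context (R : realType) dO (Omega : measurableType dO) (P : probability Omega R).
Context dY (Y : measurableType dY) (mu : {finite_measure set Y -> \bar R}).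
Variables (g : nat -> {RV P >-> R[i]}) (e : nat -> {mfun Y >-> R[i]}).
Hypotheses (indepg : mutually_independent g).
Hypothesis gaussg : forall n, complex_gaussian 1 (g n).

Lemma orthonormal_sqr_norm n : orthonormal_basis_L2 mu e ->
  (\int[mu]_y (cabs (e n y) `^ 2)%:E = 1)%E.
Proof.
move=> [_ /(_ n n) + _]; rewrite eqxx /inner_L2 /integralC => -[+ _].
rewrite /Rintegral; under eq_integral => y _.
  rewrite (_ : complex.Re (e n y * (e n y)^*%C) = cabs (e n y) `^ 2); last first.
    rewrite powR_mulrn ?cabs_ge0// sqr_cabs.
    by case: (e n y) => a b /=; rewrite mulrN opprK -!expr2.
  over.
have := integral_cabs_powR_ge0 mu setT 2 (e n).
by case: (\int[mu]_y _)%E => [r _ /= ->| |]//= _ /eqP; rewrite eq_sym oner_eq0.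
Qed.

Lemma terms_L2_bounded : orthonormal_basis_L2 mu e -> exists K : R, forall n,
  (\int[(P \x mu)%E]_x (cabs (g n x.1 * e n x.2) `^ 2)%:E <= K%:E)%E.
Proof.
move=> he; have [K K0 moment] := gauss_sum_moment indepg gaussg (ltr0n R 2).
exists K => n; rewrite (@fubini_cabs_powR _ _ _ P _ _ mu (fun x => g n x.1 * e n x.2)); last first.
  exact: measurable_term.
rewrite -[leRHS]mule1 -(orthonormal_sqr_norm n he) -ge0_integralZl_EFin//; last 2 first.
- by move=> y _; rewrite lee_fin powR_ge0.
- exact: measurable_cabs_powR.
apply: ge0_le_integral => //.
- by move=> y _; exact: integral_cabs_powR_ge0.
- apply: (@measurable_integral_cabs_powR _ _ _ P _ _ (fun x => g n x.1 * e n x.2)).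
  exact: measurable_term.
- by apply: measurable_funeM; exact: measurable_cabs_powR.
move=> y _ /=.
(* The term of rank [n] is a Gaussian sum with a single nonzero coefficient. *)
pose a k : R[i] := if k == n then e n y else 0.
have -> : (\int[P]_w (cabs (g n w * e n y) `^ 2)%:E =
    \int[P]_w (cabs (gauss_sum g n.+1 a w) `^ 2)%:E)%E.
  apply: eq_integral => w _; rewrite /gauss_sum big_ord_recr/= {2}/a eqxx.
  by rewrite big1 ?add0r// => k _; rewrite /a ltn_eqF// mulr0.
apply: (le_trans (moment n.+1 a)).
rewrite big_ord_recr/= {2}/a eqxx big1 ?add0r; last first.
  by move=> k _; rewrite /a ltn_eqF// cabs0 expr0n.
by rewrite mulfV// powRr1 ?sqr_ge0// -EFinM powR_mulrn ?cabs_ge0.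
Qed.

(** The sequence [b] is a sum of point masses, [2 ^- k.+1] at the rank [nu k] for
    each [k]. Masses at coinciding ranks are added, and the total mass is one. *)
Lemma summable_weights (nu : nat -> nat) : exists b : nat -> R,
  [/\ forall n, 0 <= b n, forall N, \sum_(n < N) b n <= 1 &
      forall k, (2 ^ k.+1)%:R^-1 <= b (nu k)].
Proof.
pose t n k : \bar R := if nu k == n then (1 / (2 ^ k.+1)%:R)%:E else 0%E.
have t0 n k : (0 <= t n k)%E by rewrite /t; case: ifP => // _; rewrite lee_fin.
pose B n := (\sum_(0 <= k <oo) t n k)%E.
have B0 n : (0 <= B n)%E by apply: nneseries_ge0.
have BN N : (\sum_(n < N) B n <= 1%:E)%E.
  rewrite /B -nneseries_sum//.
  apply: (le_trans _ (epsilon_trick0 xpredT ler01)).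
  apply: lee_nneseries => [k _ _|k _]; first exact: sume_ge0.
  have [kN|Nk] := ltnP (nu k) N.
    rewrite (bigD1 (Ordinal kN))//= big1 ?adde0; first by rewrite /t eqxx.
    by move=> n; rewrite -val_eqE/= /t eq_sym => /negPf ->.
  rewrite big1 ?lee_fin// => n _; rewrite /t gtn_eqF//.
  exact: leq_trans Nk.
have Bfin n : B n \is a fin_num.
  rewrite ge0_fin_numE// (le_lt_trans _ (ltry 1))//.
  apply: le_trans (BN n.+1); rewrite big_ord_recr/= leeDr//; exact: sume_ge0.
exists (fine \o B); split => [n|N|k] /=.
- exact: fine_ge0.
- rewrite -lee_fin -sumEFin; apply: le_trans (BN N).
  by apply: lee_sum => n _; rewrite fineK.
- rewrite -lee_fin fineK//.
  apply: (@le_trans _ _ (\sum_(0 <= j < k.+1) t (nu k) j)%E).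
    rewrite big_nat_recr//= {2}/t eqxx mul1r leeDr//.
    exact: sume_ge0.
  exact: nneseries_lim_ge.
Qed.

(** If the supremum is infinite, then ranks [nu k] can be chosen where the norm is
    larger than [4 ^ k.+1], possibly infinite. With the coefficients [b] given by
    [summable_weights] the products of [series_term_bound] at these ranks are at
    least [(2 ^ k.+1) `^ p]. *)
Lemma basis_norms_bounded (p : R) : 1 <= p -> orthonormal_basis_L2 mu e ->
  (forall c : nat -> R[i], in_l2 c -> {ae P, forall w,
     (LnormC mu p (fun y => random_series mu g e c (w, y)) < +oo)%E}) ->
  (ereal_sup (range (fun n => LnormC mu p (e n))) < +oo)%E.
Proof.
move=> p1 he finite_norm; have p0 : 0 < p by lra.
rewrite ltNge leye_eq; apply/negP => /eqP supE.
have /choice[nu nuP] : forall k, exists n, (((4 ^ k.+1)%:R : R)%:E < LnormC mu p (e n))%E.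
  move=> k; have : (((4 ^ k.+1)%:R : R)%:E < ereal_sup (range (fun n => LnormC mu p (e n))))%E.
    by rewrite supE ltry.
  by move=> /ereal_sup_gt[_ [n _ <-] ?]; exists n.
have [b [b0 bN bnu]] := summable_weights nu.
pose c n : R[i] := (b n)%:C%C.
have cE n : cabs (c n) = b n by rewrite cabs_real ger0_norm.
have c_l2 : in_l2 c.
  apply: (@le_lt_trans _ _ 1%E); last exact: ltry.
  apply: lime_le; first by apply: is_cvg_nneseries => n _ _; rewrite lee_fin sqr_ge0.
  apply: nearW => N; rewrite big_mkord sumEFin lee_fin.
  apply: le_trans (bN N); apply: ler_sum => n _; rewrite cE expr2 ler_piMl//.
  by apply: le_trans (bN n.+1); rewrite big_ord_recr/= lerDr sumr_ge0.
have c_cvg : cvgn (fun N => \sum_(n < N) cabs (c n)).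
  apply: nondecreasing_is_cvgn.
    move=> m n mn; rewrite -!(big_mkord xpredT (fun n => cabs (c n))).
    by apply: nondecreasing_series mn => k _ _; exact: cabs_ge0.
  by exists 1 => _ [N _ <-]; under eq_bigr do rewrite cE.
have [K terms] := terms_L2_bounded he.
have series_c : is_random_series mu g e c (random_series mu g e c).
  have [F FP] := random_series_exists c_cvg terms.
  by rewrite /random_series; case: xgetP => [G _ //|/(_ F)].
have [M MP] := series_term_bound indepg gaussg p0 series_c (finite_norm c c_l2).
pose k := Num.bound M.
have := MP (nu k); rewrite cE; apply/negP; rewrite -ltNge.
have intp : (((4 ^ k.+1)%:R `^ p)%:E <= \int[mu]_y (cabs (e (nu k) y) `^ p)%:E)%E.
  rewrite leNgt; apply/negP; rewrite -lt_poweRV ?integral_cabs_powR_ge0 ?ltr0n ?expn_gt0//.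
  by rewrite -LnormCE ?gt_eqF// ltNge (ltW (nuP k)).
apply: (@lt_le_trans _ _ ((b (nu k) `^ p)%:E * ((4 ^ k.+1)%:R `^ p)%:E)%E); last first.
  by rewrite lee_wpmul2l// lee_fin powR_ge0.
rewrite -EFinM lte_fin -powRM//.
have bk : (2 ^ k.+1)%:R <= b (nu k) * (4 ^ k.+1)%:R.
  apply: le_trans (ler_wpM2r _ (bnu k)) => //.
  by rewrite (expnMn 2 2) natrM mulrA mulVf ?mul1r// pnatr_eq0 expn_eq0.
have one_le : 1 <= b (nu k) * (4 ^ k.+1)%:R.
  by apply: le_trans bk; rewrite ler1n expn_gt0.
apply: (@lt_le_trans _ _ (b (nu k) * (4 ^ k.+1)%:R)); last first.
  by rewrite -[leLHS]powRr1 ?(le_trans ler01 one_le)// ler_powR.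
apply: lt_le_trans bk; apply: (lt_trans (unstable.ltr_bound M)).
by rewrite ltr_nat -/k (leq_trans (ltn_expl k (ltnSn 1)))// leq_exp2l.
Qed.

End norms_of_basis.

(** * Sufficiency of bounded norms *)

Section truncation.
Context (R : realType).

(** The truncation at the level [k] turns the power [p] of the distance [d] into
    its square, at the price of a power of [k]; only the square is known to have a
    small integral when this is applied to the partial sums. *)
Lemma min_powR_le (p k a b d : R) : 2 <= p -> 0 <= k -> 0 <= a -> 0 <= b -> 0 <= d ->
  a <= b + d ->
  Num.min a k `^ p <= 2 `^ p * (b `^ p + k `^ (p - 2) * d `^ 2).
Proof.
move=> p2 k0 a0 b0 d0 abd; have p0 : 0 <= p by lra.
have min0 : 0 <= Num.min a k by rewrite le_min a0.
have mono (x y q : R) : 0 <= q -> 0 <= x -> x <= y -> x `^ q <= y `^ q.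
  by move=> q0 x0 xy; apply: ge0_ler_powR; rewrite ?nnegrE// (le_trans x0).
have T1 : 0 <= b `^ p by exact: powR_ge0.
have T2 : 0 <= k `^ (p - 2) * d `^ 2 by rewrite mulr_ge0 ?powR_ge0.
rewrite mulrDr; have [db|bd] := leP d b.
  apply: (@le_trans _ _ (2 `^ p * b `^ p)); last by rewrite lerDl mulr_ge0 ?powR_ge0.
  rewrite -powRM//; apply: mono => //.
  by rewrite ge_min; apply/orP; left; lra.
apply: (@le_trans _ _ (2 `^ p * (k `^ (p - 2) * d `^ 2))); last first.
  by rewrite lerDr mulr_ge0 ?powR_ge0.
have [->|minN0] := eqVneq (Num.min a k) 0.
  by rewrite powR0 ?mulr_ge0 ?powR_ge0// gt_eqF//; lra.
rewrite -[in leLHS](subrK 2 p) [leLHS]powRD ?minN0 ?implybT//.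
rewrite mulrCA ler_pM ?powR_ge0//.
  by apply: mono; rewrite ?subr_ge0// ge_min lexx orbT.
apply: (@le_trans _ _ ((2 * d) `^ 2)).
  by apply: mono => //; rewrite ge_min; apply/orP; left; lra.
rewrite powRM//; apply: ler_wpM2r; first exact: powR_ge0.
by apply: ler_powR => //; rewrite ler1n.
Qed.

End truncation.

Section finite_norm.
Context (R : realType) dO (Omega : measurableType dO) (P : probability Omega R).
Context dY (Y : measurableType dY) (mu : {finite_measure set Y -> \bar R}).
Variables (g : nat -> {RV P >-> R[i]}) (e : nat -> {mfun Y >-> R[i]}).
Hypotheses (indepg : mutually_independent g).
Hypothesis gaussg : forall n, complex_gaussian 1 (g n).

(** Fubini's theorem reduces the bound to Gaussian moments at a fixed [y], where
    the variance is a sum of the [cabs (e n y) ^+ 2] with weights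
    [cabs (c n) ^+ 2]; the power mean inequality for these weights applies since
    [p / 2] is at least one. *)
Lemma partial_series_Lp_bounded (p W J : R) (c : nat -> R[i]) : 2 <= p ->
  (forall N, \sum_(n < N) cabs (c n) ^+ 2 <= W) ->
  (forall n, \int[mu]_y (cabs (e n y) `^ p)%:E <= J%:E)%E ->
  exists A : R, forall N,
  (\int[(P \x mu)%E]_x (cabs (partial_series g e c N x) `^ p)%:E <= A%:E)%E.
Proof.
move=> p2 cW eJ; have p0 : 0 < p by lra.
have [K K0 moment] := gauss_sum_moment indepg gaussg p0.
have W0 : 0 <= W by apply: le_trans (cW 0%N); rewrite big_ord0.
have J0 : 0 <= J by rewrite -lee_fin (le_trans _ (eJ 0%N))// integral_cabs_powR_ge0.
pose q := p / 2; have q1 : 1 <= q by rewrite ler_pdivlMr// mul1r.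
exists (K * (W `^ (q - 1) * (W * J))) => N.
have mS := @measurable_partial_series _ _ _ P _ _ g e c N.
rewrite fubini_cabs_powR//.
pose w n := cabs (c n) ^+ 2.
have w0 n : 0 <= w n by exact: sqr_ge0.
have me n : measurable_fun setT (fun y => (cabs (e n y) `^ p)%:E).
  exact: measurable_cabs_powR.
apply: (@le_trans _ _ (\int[mu]_y (K%:E * ((W `^ (q - 1))%:E *
    \sum_(n < N) ((w n)%:E * (cabs (e n y) `^ p)%:E))))%E).
  apply: ge0_le_integral => //.
  - by move=> y _; exact: integral_cabs_powR_ge0.
  - exact: measurable_integral_cabs_powR.
  - do 2 apply: measurable_funeM; apply: emeasurable_sum => n.
    exact: measurable_funeM.
  move=> y _.
  under eq_integral do rewrite partial_seriesE.
  apply: (le_trans (moment N _)).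
  rewrite (eq_bigr (fun n : 'I_N => (w n * cabs (e n y) `^ p)%:E)); last first.
    by move=> n _; rewrite EFinM.
  rewrite sumEFin -!EFinM lee_fin ler_wpM2l//.
  rewrite (eq_bigr (fun n : 'I_N => w n * cabs (e n y) ^+ 2)); last first.
    by move=> n _; rewrite cabsM exprMn.
  apply: (le_trans (power_mean (x := fun n => cabs (e n y) ^+ 2) N q1 w0 _)).
    by move=> n; exact: sqr_ge0.
  rewrite [X in _ * X <= _](eq_bigr (fun n : 'I_N => w n * cabs (e n y) `^ p)); last first.
    by move=> n _ /=; rewrite -powR_mulrn ?cabs_ge0// -powRrM mulrCA mulfV// mulr1.
  rewrite ler_wpM2r//.
    by apply: sumr_ge0 => n _; rewrite mulr_ge0 ?powR_ge0.
  apply: ge0_ler_powR; rewrite ?nnegrE ?subr_ge0//; first exact: sumr_ge0.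
have msum : measurable_fun setT (fun y =>
    \sum_(n < N) ((w n)%:E * (cabs (e n y) `^ p)%:E))%E.
  by apply: emeasurable_sum => n; exact: measurable_funeM.
have sum0 y : (0 <= \sum_(n < N) ((w n)%:E * (cabs (e n y) `^ p)%:E))%E.
  by apply: sume_ge0 => n _; rewrite mule_ge0// lee_fin ?powR_ge0.
rewrite ge0_integralZl_EFin//; last 2 first.
- by move=> y _; rewrite mule_ge0// lee_fin powR_ge0.
- exact: measurable_funeM.
rewrite ge0_integralZl_EFin ?powR_ge0// !EFinM.
apply: lee_wpmul2l; first by rewrite lee_fin.
apply: lee_wpmul2l; first by rewrite lee_fin powR_ge0.
rewrite ge0_integral_sum//; last 2 first.
- by move=> n; exact: measurable_funeM.
- by move=> n y _; rewrite mule_ge0// lee_fin ?powR_ge0.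
apply: (@le_trans _ _ (\sum_(n < N) ((w n)%:E * J%:E))%E).
  apply: lee_sum => n _; rewrite ge0_integralZl_EFin//; last first.
    by move=> y _; rewrite lee_fin powR_ge0.
  by apply: lee_wpmul2l; rewrite ?lee_fin.
rewrite (eq_bigr (fun n : 'I_N => (w n * J)%:E)); last by move=> n _; rewrite EFinM.
by rewrite sumEFin -mulr_suml -EFinM lee_fin; apply: ler_wpM2r => //; exact: cW.
Qed.

(** The bound passes to the limit for the truncations of [F], whose powers are
    controlled by the partial sums and the mean square distance, and then to [F]
    by monotone convergence. *)
Lemma random_series_Lp (p A : R) (c : nat -> R[i])
    (F : {mfun (Omega * Y)%type >-> R[i]}) : 2 <= p ->
  is_random_series mu g e c F ->
  (forall N, \int[(P \x mu)%E]_x (cabs (partial_series g e c N x) `^ p)%:E <= A%:E)%E ->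
  (\int[(P \x mu)%E]_x (cabs (F x) `^ p)%:E < +oo)%E.
Proof.
move=> p2 [_ cvgF] SA; have p0 : 0 < p by lra.
pose m := (P \x mu)%E.
have mF : measurable_fun setT F by exact: measurable_funP.
have mS N := @measurable_partial_series _ _ _ P _ _ g e c N.
have mSF N : measurable_fun setT (fun x => partial_series g e c N x - F x).
  exact: measurable_complexB.
have mcF : measurable_fun setT (fun x => cabs (F x)) by exact: measurable_fun_cabs.
have {}cvgF : (\int[m]_x (cabs (partial_series g e c N x - F x) `^ 2)%:E
    @[N --> \oo] --> 0)%E.
  by move/LnormC_cvg0 : cvgF; exact.
pose t (k : nat) x := Num.min (cabs (F x)) k%:R `^ p.
have t0 k x : (0 <= (t k x)%:E)%E by rewrite lee_fin powR_ge0.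
have mt k : measurable_fun setT (fun x => (t k x)%:E).
  apply/measurable_EFinP; apply: (measurableT_comp (measurable_powR p)).
  by apply: measurable_minr => //; exact: measurable_cst.
pose L := 2 `^ p * (A + 1).
have tL k : (\int[m]_x (t k x)%:E <= L%:E)%E.
  pose kp : R := k%:R `^ (p - 2).
  have kp0 : 0 <= kp by exact: powR_ge0.
  have kp1 : 0 < (kp + 1)^-1 by rewrite invr_gt0 ltr_wpDl.
  (* A single partial sum, depending on [k], is close enough to absorb the power
     of the truncation level. *)
  have [N /(_ N (leqnn N)) NP] := (cvge0P (fun N => integral_cabs_powR_ge0 m setT 2
    (fun x => partial_series g e c N x - F x))).1 cvgF _ kp1.
  apply: (@le_trans _ _ (\int[m]_x ((2 `^ p)%:E *
    ((cabs (partial_series g e c N x) `^ p)%:E +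
     kp%:E * (cabs (partial_series g e c N x - F x) `^ 2)%:E)))%E).
    apply: ge0_le_integral => //.
    - apply: measurable_funeM; apply: emeasurable_funD.
        exact: measurable_cabs_powR.
      by apply: measurable_funeM; exact: measurable_cabs_powR.
    move=> x _; rewrite -!(EFinM, EFinD) lee_fin.
    apply: min_powR_le; rewrite ?cabs_ge0//.
    rewrite addrC -[cabs (_ - _)]normcN opprB.
    by rewrite -[X in cabs X <= _](subrK (partial_series g e c N x) (F x)) le_normcD.
  have m1 := measurable_cabs_powR p (mS N).
  have m2 := measurable_cabs_powR 2 (mSF N).
  have pos1 x : (0 <= (cabs (partial_series g e c N x) `^ p)%:E)%E.
    by rewrite lee_fin powR_ge0.
  have pos2 x : (0 <= (cabs (partial_series g e c N x - F x) `^ 2)%:E)%E.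
    by rewrite lee_fin powR_ge0.
  have pos3 x : (0 <= kp%:E * (cabs (partial_series g e c N x - F x) `^ 2)%:E)%E.
    by rewrite mule_ge0.
  have m3 : measurable_fun setT (fun x =>
      kp%:E * (cabs (partial_series g e c N x - F x) `^ 2)%:E)%E.
    exact: measurable_funeM.
  rewrite ge0_integralZl_EFin ?powR_ge0//; last 2 first.
  - by move=> x _; rewrite adde_ge0.
  - exact: emeasurable_funD.
  rewrite ge0_integralD// ge0_integralZl_EFin// /L EFinM.
  apply: lee_wpmul2l; first by rewrite lee_fin powR_ge0.
  rewrite EFinD; apply: leeD; first exact: SA.
  apply: (@le_trans _ _ (kp%:E * (kp + 1)^-1%:E)%E).
    by apply: lee_wpmul2l; rewrite ?lee_fin// ltW.
  by rewrite -EFinM lee_fin ler_pdivrMr ?mul1r ?lerDl// ltr_wpDl.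
have tcvg x : (t k x)%:E @[k --> \oo] --> (cabs (F x) `^ p)%:E.
  apply: cvg_near_cst; exists (Num.trunc (cabs (F x))).+1 => // k /= kF.
  rewrite /t min_l//; apply: ltW; apply: lt_le_trans (truncnS_gt _) _.
  by rewrite ler_nat.
have nd_t x : {homo (fun k => (t k x)%:E) : n k / (n <= k)%N >-> (n <= k)%E}.
  move=> n k nk; rewrite lee_fin; apply: ge0_ler_powR.
  - exact: ltW.
  - by rewrite nnegrE le_min cabs_ge0 ler0n.
  - by rewrite nnegrE le_min cabs_ge0 ler0n.
  - by rewrite le_min !ge_min lexx/= ler_nat nk orbT.
apply: (@le_lt_trans _ _ L%:E); last exact: ltry.
rewrite (eq_integral (fun x => limn (fun k => (t k x)%:E))); last first.
  by move=> x _; apply/esym/cvg_lim => //; exact: tcvg.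
rewrite monotone_convergence//.
apply: lime_le; last by apply: nearW => k; exact: tL.
apply: ereal_nondecreasing_is_cvgn => n k nk; apply: ge0_le_integral => //.
by move=> x _; exact: nd_t.
Qed.

Lemma random_series_finite_norm (p : R) : 2 <= p ->
  (ereal_sup (range (fun n => LnormC mu p (e n))) < +oo)%E ->
  forall c : nat -> R[i], in_l2 c -> {ae P, forall w,
    (LnormC mu p (fun y => random_series mu g e c (w, y)) < +oo)%E}.
Proof.
move=> p2 supe c c_l2; have p0 : 0 < p by lra.
(* If the partial sums had no limit, the representative would be zero. *)
rewrite /random_series; case: xgetP => [F _ FP|_]; last first.
  apply: nearW => w; apply/LnormC_lty => //.
  rewrite (eq_integral (cst 0%E)) ?integral0 ?ltry// => y _.
  by rewrite [X in (X `^ p)%:E](_ : _ = 0) ?powR0 ?gt_eqF//; exact: cabs0.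
set s := ereal_sup _ in supe.
have eJ n : (\int[mu]_y (cabs (e n y) `^ p)%:E <= (s `^ p))%E.
  have es : (LnormC mu p (e n) <= s)%E by apply: ereal_sup_ubound; exists n.
  rewrite (_ : (\int[mu]_y _)%E = (LnormC mu p (e n) `^ p)%E); last first.
    rewrite LnormCE ?gt_eqF// -poweRrM mulVf ?gt_eqF// poweRe1//.
    exact: integral_cabs_powR_ge0.
  apply: gt0_ler_poweR => //; rewrite ?(ltW p0)// in_itv/= ?Lnorm_ge0 ?leey//.
  by rewrite (le_trans _ es) ?Lnorm_ge0.
have [W cW] : exists W : R, forall N, \sum_(n < N) cabs (c n) ^+ 2 <= W.
  exists (fine (\sum_(0 <= n <oo) (cabs (c n) ^+ 2)%:E)) => N.
  rewrite -lee_fin fineK; last first.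
    by rewrite ge0_fin_numE// nneseries_ge0// => n _ _; rewrite lee_fin sqr_ge0.
  rewrite -sumEFin -(big_mkord xpredT (fun n => (cabs (c n) ^+ 2)%:E)).
  by apply: nneseries_lim_ge => n _ _; rewrite lee_fin sqr_ge0.
have sfin : ((s `^ p)%E = (fine (s `^ p))%:E)%E.
  by rewrite fineK// ge0_fin_numE ?poweR_ge0// poweR_lty.
have {}eJ n : (\int[mu]_y (cabs (e n y) `^ p)%:E <= (fine (s `^ p))%:E)%E.
  by rewrite -sfin.
have [A SA] := partial_series_Lp_bounded p2 cW eJ.
have mF : measurable_fun setT F by exact: measurable_funP.
have := random_series_Lp p2 FP SA.
rewrite fubini_tonelli1//; last 2 first.
- exact: measurable_cabs_powR.
- by move=> x; rewrite lee_fin powR_ge0.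
set Phi := fubini_F _ _ => Phifin.
have Phi0 w : (0 <= Phi w)%E by exact: integral_cabs_powR_ge0.
have /integrable_ae : P.-integrable setT Phi.
  apply/integrableP; split.
    apply: measurable_fun_fubini_tonelli_F; first exact: measurable_cabs_powR.
    by move=> x; rewrite lee_fin powR_ge0.
  by under eq_integral do rewrite gee0_abs//.
move=> /(_ measurableT); apply: filterS => w /(_ I).
by rewrite ge0_fin_numE// => ?; apply/LnormC_lty.
Qed.

End finite_norm.

(** * The equivalence *)

Theorem theorem1 (R : realType) (p : R) (hp : 2 <= p)
  (dY : measure_display) (Y : measurableType dY)
  (mu : {finite_measure set Y -> \bar R})
  (e : nat -> {mfun Y >-> R[i]}) (he : orthonormal_basis_L2 mu e)
  (dO : measure_display) (Omega : measurableType dO)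
  (P : probability Omega R)
  (g : nat -> {RV P >-> R[i]})
  (hg_indep : mutually_independent g)
  (hg_gauss : forall n, complex_gaussian 1 (g n)) :
  (forall c : nat -> R[i], in_l2 c ->
     {ae P, forall w : Omega,
        (LnormC mu p (fun y => random_series mu g e c (w, y)) < +oo)%E})
  <->
  (ereal_sup (range (fun n => LnormC mu p (e n))) < +oo)%E.
Proof.
split.
  by apply: basis_norms_bounded => //; lra.
exact: random_series_finite_norm.
Qed.
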